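(* It is provable in $\mathbf{ZF}$ that the statement $\mathbf{IQDI}(\mathcal{P})$ is equivalent to the statement: every infinite discrete space admits a clopen matrix.
   Context: The base theory is $\mathbf{ZF}$, with no form of the axiom of choice assumed. A set is infinite if it is not equipotent with any $n\in\omega$, and denumerable if it is equipotent with $\omega$. $\mathbf{IQDI}(\mathcal{P})$: for every infinite set $X$, the set $[\mathcal{P}(X)]^{<\omega}$ of all finite subsets of the power set $\mathcal{P}(X)$ has a denumerable subset. A cellular family of a space is a set of pairwise disjoint non-empty open subsets of it. A clopen matrix of a topological space $\mathbf{X}$ is a collection $\{\mathcal{C}_n: n\in\mathbb{N}\}$ of finite cellular families of $\mathbf{X}$ such that $\mathcal{C}_m\neq\mathcal{C}_n$ whenever $m\neq n$ and, for each $n\in\mathbb{N}$, all members of $\mathcal{C}_n$ are clopen in $\mathbf{X}$ and $\bigcup\mathcal{C}_n=X$. *)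

(* Defs.v *)
From Stdlib Require Import List Arith.
Import ListNotations.

(** * First-order logic with equality over the signature {∈}

    Variables are de Bruijn indices.  There are no function symbols, so the
    only terms are variables and substitution is renaming. *)

Inductive form : Type :=
| Mem (i j : nat)
| Eq (i j : nat)
| Bot
| Imp (p q : form)
| All (p : form).

Definition scons {A : Type} (a : A) (s : nat -> A) (i : nat) : A :=
  match i with O => a | S j => s j end.

Fixpoint ren (r : nat -> nat) (p : form) : form :=
  match p with
  | Mem i j => Mem (r i) (r j)
  | Eq i j => Eq (r i) (r j)
  | Bot => Bot
  | Imp p q => Imp (ren r p) (ren r q)
  | All p => All (ren (scons 0 (fun i => S (r i))) p)
  end.

Definition shift : form -> form := ren S.

Definition inst (p : form) (t : nat) : form := ren (scons t (fun i => i)) p.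

(** All free variables of [p] are [< n]. *)
Fixpoint bounded (n : nat) (p : form) : Prop :=
  match p with
  | Mem i j | Eq i j => i < n /\ j < n
  | Bot => True
  | Imp p q => bounded n p /\ bounded n q
  | All p => bounded (S n) p
  end.

(** Classical natural deduction. *)
Inductive derives : list form -> form -> Prop :=
| d_hyp G p : In p G -> derives G p
| d_impI G p q : derives (p :: G) q -> derives G (Imp p q)
| d_impE G p q : derives G (Imp p q) -> derives G p -> derives G q
| d_allI G p : derives (map shift G) p -> derives G (All p)
| d_allE G p t : derives G (All p) -> derives G (inst p t)
| d_raa G p : derives (Imp p Bot :: G) Bot -> derives G p
| d_eq_refl G t : derives G (Eq t t)
| d_eq_subst G p s t :
    derives G (Eq s t) -> derives G (inst p s) -> derives G (inst p t).

Definition provable (T : form -> Prop) (p : form) : Prop :=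
  exists G : list form, (forall q, In q G -> T q) /\ derives G p.

(** * Formulas with named bound variables

    A [fm] is a formula relative to the number [d] of quantifiers in scope.  A
    variable is represented by its de Bruijn level, i.e. the number of
    quantifiers in scope outside its own binder, so that a predicate of the
    language is a Rocq function on variables and quantifiers bind Rocq
    variables.  [fm_all] hands its body the level of the new variable; atoms
    turn levels into indices. *)

Definition var : Type := nat.
Definition fm : Type := nat -> form.

Definition index (d : nat) (x : var) : nat := d - S x.

Definition fm_mem (x y : var) : fm := fun d => Mem (index d x) (index d y).
Definition fm_eq (x y : var) : fm := fun d => Eq (index d x) (index d y).
Definition fm_imp (p q : fm) : fm := fun d => Imp (p d) (q d).
Definition fm_not (p : fm) : fm := fun d => Imp (p d) Bot.
Definition fm_and (p q : fm) : fm := fm_not (fm_imp p (fm_not q)).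
Definition fm_or (p q : fm) : fm := fm_imp (fm_not p) q.
Definition fm_iff (p q : fm) : fm := fm_and (fm_imp p q) (fm_imp q p).
Definition fm_all (p : var -> fm) : fm := fun d => All (p d (S d)).
Definition fm_ex (p : var -> fm) : fm := fm_not (fm_all (fun x => fm_not (p x))).

Definition sentence (p : fm) : form := p 0.

Declare Scope fm_scope.
Delimit Scope fm_scope with fm.
Bind Scope fm_scope with fm.

Notation "x ∈ y" := (fm_mem x y) (at level 70, no associativity) : fm_scope.
Notation "x ≐ y" := (fm_eq x y) (at level 70, no associativity) : fm_scope.
Notation "¬ p" := (fm_not p) (at level 75, right associativity) : fm_scope.
Notation "p ∧ q" := (fm_and p q) (at level 80, right associativity) : fm_scope.
Notation "p ∨ q" := (fm_or p q) (at level 85, right associativity) : fm_scope.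
Notation "p → q" := (fm_imp p q) (at level 99, q at level 200, right associativity) : fm_scope.
Notation "p ↔ q" := (fm_iff p q) (at level 95, no associativity) : fm_scope.
Notation "∀ x .. y , p" := (fm_all (fun x => .. (fm_all (fun y => p%fm)) ..))
  (at level 200, x binder, y binder, right associativity) : fm_scope.
Notation "∃ x .. y , p" := (fm_ex (fun x => .. (fm_ex (fun y => p%fm)) ..))
  (at level 200, x binder, y binder, right associativity) : fm_scope.

Open Scope fm_scope.

(** * The axioms of ZF *)

(** [schema1 p x] is [p] with its variable 0 read as [x], and [schema2 p x y]
    is [p] with its variables 0 and 1 read as [x] and [y]; the remaining
    variables are parameters, the first of them being bound by the outermost
    quantifier of the universal closure [closure n] below. *)
Definition schema1 (p : form) (x : var) : fm :=
  fun d => ren (fun i => index d (scons x (fun j => j) i)) p.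
Definition schema2 (p : form) (x y : var) : fm :=
  fun d => ren (fun i => index d (scons x (scons y (fun j => j)) i)) p.

Definition closure (n : nat) (p : fm) : form := Nat.iter n All (p n).

Definition is_empty (x : var) : fm := ∀ z, ¬ z ∈ x.
Definition subset (x y : var) : fm := ∀ z, z ∈ x → z ∈ y.
Definition is_upair (p a b : var) : fm := ∀ z, z ∈ p ↔ z ≐ a ∨ z ≐ b.
Definition is_union (u c : var) : fm := ∀ z, z ∈ u ↔ ∃ y, y ∈ c ∧ z ∈ y.
Definition is_power (p x : var) : fm := ∀ z, z ∈ p ↔ subset z x.
Definition is_succ (s n : var) : fm := ∀ z, z ∈ s ↔ z ∈ n ∨ z ≐ n.
Definition inductive_set (w : var) : fm :=
  (∃ e, is_empty e ∧ e ∈ w) ∧ (∀ n, n ∈ w → ∃ s, is_succ s n ∧ s ∈ w).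

Definition ax_extensionality : fm := ∀ x y, (∀ z, z ∈ x ↔ z ∈ y) → x ≐ y.
Definition ax_foundation : fm :=
  ∀ x, (∃ y, y ∈ x) → ∃ y, y ∈ x ∧ ¬ ∃ z, z ∈ x ∧ z ∈ y.
Definition ax_pairing : fm := ∀ a b, ∃ p, is_upair p a b.
Definition ax_union : fm := ∀ c, ∃ u, is_union u c.
Definition ax_power : fm := ∀ x, ∃ p, is_power p x.
Definition ax_infinity : fm := ∃ w, inductive_set w.
Definition ax_separation (p : form) : fm :=
  ∀ a, ∃ b, ∀ x, x ∈ b ↔ x ∈ a ∧ schema1 p x.
Definition ax_replacement (p : form) : fm :=
  ∀ a, (∀ x, x ∈ a → ∀ y y', schema2 p x y → schema2 p x y' → y ≐ y') →
    ∃ b, ∀ y, y ∈ b ↔ ∃ x, x ∈ a ∧ schema2 p x y.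

Inductive ZF : form -> Prop :=
| ZF_extensionality : ZF (sentence ax_extensionality)
| ZF_foundation : ZF (sentence ax_foundation)
| ZF_pairing : ZF (sentence ax_pairing)
| ZF_union : ZF (sentence ax_union)
| ZF_power : ZF (sentence ax_power)
| ZF_infinity : ZF (sentence ax_infinity)
| ZF_separation n p : bounded (1 + n) p -> ZF (closure n (ax_separation p))
| ZF_replacement n p : bounded (2 + n) p -> ZF (closure n (ax_replacement p)).

(** * Functions and cardinality in the language of set theory *)

(** Kuratowski pair [{{a}, {a, b}}]. *)
Definition is_pair (p a b : var) : fm :=
  ∃ s t, is_upair s a a ∧ is_upair t a b ∧ is_upair p s t.

Definition maps_to (f a b : var) : fm := ∃ p, is_pair p a b ∧ p ∈ f.

Definition is_function (f x y : var) : fm :=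
  (∀ p, p ∈ f → ∃ a b, a ∈ x ∧ b ∈ y ∧ is_pair p a b) ∧
  (∀ a, a ∈ x → ∃ b, maps_to f a b ∧ ∀ b', maps_to f a b' → b' ≐ b).

Definition is_bijection (f x y : var) : fm :=
  is_function f x y ∧
  (∀ a a' b, maps_to f a b → maps_to f a' b → a ≐ a') ∧
  (∀ b, b ∈ y → ∃ a, maps_to f a b).

Definition equipotent (x y : var) : fm := ∃ f, is_bijection f x y.

Definition is_omega (w : var) : fm :=
  inductive_set w ∧ ∀ v, inductive_set v → subset w v.

Definition finite (x : var) : fm := ∃ w n, is_omega w ∧ n ∈ w ∧ equipotent x n.
Definition infinite (x : var) : fm := ¬ finite x.
Definition denumerable (x : var) : fm := ∃ w, is_omega w ∧ equipotent x w.

(** [f] is the set of all finite subsets of [x]. *)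
Definition is_finite_subsets (f x : var) : fm :=
  ∀ z, z ∈ f ↔ subset z x ∧ finite z.

(** * Topological spaces [(x, t)], [t] being the family of open sets *)

Definition is_inter2 (w u v : var) : fm := ∀ z, z ∈ w ↔ z ∈ u ∧ z ∈ v.
Definition is_diff (w u v : var) : fm := ∀ z, z ∈ w ↔ z ∈ u ∧ ¬ z ∈ v.

Definition is_topology (x t : var) : fm :=
  (∀ u, u ∈ t → subset u x) ∧
  (∀ e, is_empty e → e ∈ t) ∧
  x ∈ t ∧
  (∀ c u, subset c t → is_union u c → u ∈ t) ∧
  (∀ u v w, u ∈ t → v ∈ t → is_inter2 w u v → w ∈ t).

Definition is_discrete_space (x t : var) : fm :=
  is_topology x t ∧ is_power t x.

Definition is_clopen (x t u : var) : fm :=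
  u ∈ t ∧ ∃ c, is_diff c x u ∧ c ∈ t.

Definition is_cellular_family (t c : var) : fm :=
  (∀ u, u ∈ c → u ∈ t ∧ ¬ is_empty u) ∧
  (∀ u v, u ∈ c → v ∈ c → ¬ u ≐ v → ¬ ∃ z, z ∈ u ∧ z ∈ v).

(** The indexed collection is a function [m] on ω. *)
Definition is_clopen_matrix (x t m : var) : fm :=
  ∃ w y, is_omega w ∧ is_function m w y ∧
    (∀ i j c c', i ∈ w → j ∈ w → ¬ i ≐ j →
       maps_to m i c → maps_to m j c' → ¬ c ≐ c') ∧
    (∀ n c, n ∈ w → maps_to m n c →
       finite c ∧ is_cellular_family t c ∧
       (∀ u, u ∈ c → is_clopen x t u) ∧ is_union x c).

(** * The two statements *)

Definition IQDI_P : fm :=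
  ∀ x, infinite x →
    ∃ p f, is_power p x ∧ is_finite_subsets f p ∧
      ∃ d, subset d f ∧ denumerable d.

Definition infinite_discrete_spaces_admit_clopen_matrices : fm :=
  ∀ x t, is_discrete_space x t → infinite x → ∃ m, is_clopen_matrix x t m.

(* Main.v *)
(**
  By the completeness theorem it suffices to prove the equivalence in every
  structure satisfying ZF; completeness is proved by Henkin's method, with the
  variables as witnesses since the axioms are closed.  Inside a structure one
  may reason freely as long as the predicates and functions fed to separation
  and replacement are definable with parameters.

  A clopen matrix of the discrete space X is an injective sequence of finite
  partitions of X, so its range is a denumerable set of finite subsets of P(X).
  Conversely, let F_0, F_1, ... be distinct finite subsets of P(X), and let C_n
  be the finite partition of X into the atoms of the field of sets generated by
  F_n.  Every member of F_n is a union of members of C_n, so C_n determines F_n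
  up to finitely many possibilities.  Hence infinitely many partitions occur
  among the C_n, and an infinite image of omega can be enumerated without
  repetition without any choice.
*)
From Stdlib Require Import List Arith Lia Cantor Classical ClassicalEpsilon
  FunctionalExtensionality PropExtensionality.
Require Import Defs.
Import ListNotations.

(** * Renaming and derivations *)

(** Excluded middle and epsilon act only in the metatheory and give no choice inside a structure:
    separation and replacement accept a predicate only together with a proof that it is definable.
    So every function used to form an image or a graph inside the structure has to be definable with
    parameters. To make such proofs syntactic, set operations are total functions built from
    [setof], whose graph is definable.

    Choice is avoided because every object is canonical. The atoms of a family are determined by the
    family; the families with a given set [C] of atoms lie in the finite set of all families of
    unions of subsets of [C]; and a finite union of finite sets is finite by induction. An infinite
    image of [omega] is enumerated by keeping the least argument of each value and counting
    predecessors among those arguments.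

    Finite means equipotent with an element of the structure's own [omega], which may look
    nonstandard from outside. Induction and counting therefore take place inside the structure,
    never by recursion on [nat]. *)

Definition up (r : nat -> nat) : nat -> nat := scons 0 (fun i => S (r i)).

Lemma ren_ext (r r' : nat -> nat) p : (forall i, r i = r' i) -> ren r p = ren r' p.
Proof. intro H. f_equal. apply functional_extensionality, H. Qed.

Lemma ren_comp p : forall r r', ren r (ren r' p) = ren (fun i => r (r' i)) p.
Proof.
  induction p; intros r r'; cbn; rewrite ?IHp, ?IHp1, ?IHp2; auto.
  f_equal. apply ren_ext. intros [|i]; reflexivity.
Qed.

Lemma ren_id p : ren (fun i => i) p = p.
Proof.
  induction p; cbn; rewrite ?IHp1, ?IHp2; auto.
  f_equal. rewrite <- IHp at 2. apply ren_ext. intros [|i]; reflexivity.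
Qed.

Lemma ren_bounded p : forall n r r', bounded n p -> (forall i, i < n -> r i = r' i) ->
  ren r p = ren r' p.
Proof.
  induction p; intros n r r' Hb H; cbn in *.
  - destruct Hb; now rewrite !H.
  - destruct Hb; now rewrite !H.
  - reflexivity.
  - destruct Hb; f_equal; eauto.
  - f_equal. apply (IHp (S n)); auto. intros [|i] Hi; cbn; auto.
    f_equal. apply H. lia.
Qed.

Lemma ren_closed p r : bounded 0 p -> ren r p = p.
Proof.
  intro H. rewrite <- (ren_id p) at 2. apply (ren_bounded _ 0); auto. lia.
Qed.

Lemma bounded_ren p : forall n m r, bounded n p -> (forall i, i < n -> r i < m) ->
  bounded m (ren r p).
Proof.
  induction p; intros n m r Hb H; cbn in *.
  - destruct Hb; auto.
  - destruct Hb; auto.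
  - auto.
  - destruct Hb; eauto.
  - apply (IHp (S n)); auto. intros [|i] Hi; cbn; [lia|].
    apply -> Nat.succ_lt_mono. apply H. lia.
Qed.

Lemma bounded_mono p n m : n <= m -> bounded n p -> bounded m p.
Proof.
  intros H Hb. rewrite <- (ren_id p). apply (bounded_ren _ n); auto. lia.
Qed.

Lemma bounded_ex p : exists n, bounded n p.
Proof.
  induction p as [i j|i j| |p [n Hn] q [m Hm]|p [n Hn]].
  - exists (S (i + j)); cbn; lia.
  - exists (S (i + j)); cbn; lia.
  - exists 0; exact I.
  - exists (n + m); split; [apply (bounded_mono p n)|apply (bounded_mono q m)]; auto; lia.
  - exists n; cbn. apply (bounded_mono p n); auto.
Qed.

Lemma ren_inst r p t : ren r (inst p t) = inst (ren (up r) p) (r t).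
Proof.
  unfold inst. rewrite !ren_comp. apply ren_ext. intros [|i]; reflexivity.
Qed.

Lemma derives_weaken G p : derives G p -> forall G', incl G G' -> derives G' p.
Proof.
  induction 1; intros G' HG.
  - apply d_hyp; auto.
  - apply d_impI, IHderives. intros x [->|Hx]; [now left|right; auto].
  - eapply d_impE; eauto.
  - apply d_allI, IHderives. apply incl_map; auto.
  - apply d_allE; auto.
  - apply d_raa, IHderives. intros x [->|Hx]; [now left|right; auto].
  - apply d_eq_refl.
  - eapply d_eq_subst; eauto.
Qed.

Lemma derives_ren G p : derives G p -> forall r, derives (map (ren r) G) (ren r p).
Proof.
  induction 1; intro r; cbn in *.
  - apply d_hyp, in_map; auto.
  - apply d_impI, IHderives.
  - eapply d_impE; eauto.
  - apply d_allI. specialize (IHderives (up r)). rewrite map_map in IHderives.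
    rewrite map_map. erewrite map_ext; [exact IHderives|].
    intro a. unfold shift. rewrite !ren_comp. reflexivity.
  - rewrite ren_inst. apply d_allE, IHderives.
  - apply d_raa, IHderives.
  - apply d_eq_refl.
  - rewrite ren_inst. eapply d_eq_subst; [apply IHderives1|].
    rewrite <- ren_inst. apply IHderives2.
Qed.

(** The eigenvariable rule for a named fresh variable. The renaming that sends [n] to 0 and shifts
    all other variables acts as [shift] on [G], which does not mention [n], and undoes the
    instantiation of [p]. *)
Lemma derives_generalize G p n :
  (forall q, In q G -> bounded n q) -> bounded (S n) p ->
  derives G (inst p n) -> derives G (All p).
Proof.
  intros HG Hp H. apply d_allI.
  apply derives_ren with (r := fun i => if i =? n then 0 else S i) in H.
  replace (map shift G) with (map (ren (fun i => if i =? n then 0 else S i)) G).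
  - replace p with (ren (fun i => if i =? n then 0 else S i) (inst p n)); auto.
    unfold inst. rewrite ren_comp. rewrite <- (ren_id p) at 2.
    apply (ren_bounded _ (S n)); auto.
    intros [|i] Hi; cbn; [now rewrite Nat.eqb_refl|].
    destruct (Nat.eqb_spec i n); lia.
  - apply map_ext_in. intros q Hq. apply (ren_bounded _ n); auto.
    intros i Hi. destruct (Nat.eqb_spec i n); lia.
Qed.

(** * The completeness theorem *)

Definition with_axiom (A : form -> Prop) (p q : form) : Prop := A q \/ q = p.
Definition consistent (A : form -> Prop) : Prop := ~ provable A Bot.

Lemma provable_hyp (A : form -> Prop) p : A p -> provable A p.
Proof.
  intro H. exists [p]. split; [intros q [<-|[]]; auto|]. apply d_hyp. now left.
Qed.

Lemma provable_mono (A B : form -> Prop) p :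
  (forall q, A q -> B q) -> provable A p -> provable B p.
Proof. intros H (G & HG & D). exists G; auto. Qed.

Lemma provable_impE A p q : provable A (Imp p q) -> provable A p -> provable A q.
Proof.
  intros (G & HG & D) (G' & HG' & D'). exists (G ++ G'). split.
  - intros r Hr. apply in_app_iff in Hr as [|]; auto.
  - eapply d_impE; eapply derives_weaken; eauto using incl_appl, incl_appr, incl_refl.
Qed.

Lemma provable_rule A p q :
  (forall G, derives G p -> derives G q) -> provable A p -> provable A q.
Proof. intros H (G & HG & D). exists G; auto. Qed.

(** Gathers all uses of [p] at the head of the context, where [d_raa] and [d_impI] can discharge
    them. *)
Lemma derives_split A p G : (forall q, In q G -> with_axiom A p q) ->
  exists G', (forall q, In q G' -> A q) /\ incl G (p :: G').
Proof.
  induction G as [|a G IH]; intro H.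
  - exists []. split; [intros q []|intros q []].
  - destruct IH as (G' & HG' & Hi); [intros; apply H; now right|].
    destruct (H a (or_introl eq_refl)) as [Ha| ->].
    + exists (a :: G'). split; [intros q [<-|]; auto|].
      intros q [<-|Hq]; [right; now left|].
      destruct (Hi _ Hq); [now left|right; now right].
    + exists G'. split; auto. intros q [<-|Hq]; [now left|auto].
Qed.

Lemma provable_raa A p : ~ consistent (with_axiom A (Imp p Bot)) -> provable A p.
Proof.
  intro H. apply NNPP in H as (G & HG & D).
  apply derives_split in HG as (G' & HG' & Hi). exists G'. split; auto.
  apply d_raa. eapply derives_weaken; eauto.
Qed.

Lemma provable_not A p : ~ consistent (with_axiom A p) -> provable A (Imp p Bot).
Proof.
  intro H. apply NNPP in H as (G & HG & D).
  apply derives_split in HG as (G' & HG' & Hi). exists G'. split; auto.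
  apply d_impI. eapply derives_weaken; eauto.
Qed.

Fixpoint code (p : form) : nat :=
  match p with
  | Mem i j => to_nat (0, to_nat (i, j))
  | Eq i j => to_nat (1, to_nat (i, j))
  | Bot => to_nat (2, 0)
  | Imp p q => to_nat (3, to_nat (code p, code q))
  | All p => to_nat (4, code p)
  end.

Lemma to_nat_eq a b c d : to_nat (a, b) = to_nat (c, d) -> a = c /\ b = d.
Proof.
  intro H. apply (f_equal of_nat) in H. rewrite !cancel_of_to in H.
  now inversion H.
Qed.

Lemma code_inj p : forall q, code p = code q -> p = q.
Proof.
  induction p; intros [] H; cbn [code] in H; apply to_nat_eq in H as [H0 H];
    try discriminate; auto; try (apply to_nat_eq in H as [H1 H2]);
    f_equal; auto.
Qed.

(** Numbers that code no formula receive an arbitrary one. This is harmless: the construction only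
    needs each formula to have its turn at its own code. *)
Definition enum (k : nat) : form := epsilon (inhabits Bot) (fun p => code p = k).

Lemma enum_code p : enum (code p) = p.
Proof.
  apply code_inj. unfold enum. apply epsilon_spec. now exists p.
Qed.

(** * Maximal consistent Henkin extensions and the term model *)

Section Henkin.
Variable A0 : form -> Prop.
Hypothesis A0_closed : forall q, A0 q -> bounded 0 q.
Hypothesis A0_consistent : consistent A0.

(** Variable 0 of [p] is the one to be quantified, so the second clause puts [n] beyond the free
    variables of [All p]. *)
Definition fresh (A : form -> Prop) (p : form) (n : nat) : Prop :=
  (forall q, A q -> bounded n q) /\ bounded (S n) p.

Definition extend (A : form -> Prop) (p q : form) : Prop :=
  A q \/ consistent (with_axiom A p) /\
    (q = p \/ exists p', p = Imp (All p') Bot /\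
       q = Imp (inst p' (epsilon (inhabits 0) (fresh A p'))) Bot).

Fixpoint stage (k : nat) : form -> Prop :=
  match k with O => A0 | S k => extend (stage k) (enum k) end.

Definition limit (q : form) : Prop := exists k, stage k q.

Lemma fresh_ex A p n : (forall q, A q -> bounded n q) ->
  fresh A p (epsilon (inhabits 0) (fresh A p)).
Proof.
  intro H. apply epsilon_spec. destruct (bounded_ex p) as [m Hm].
  exists (n + m). split; [intros q Hq|]; (eapply bounded_mono; [|eauto]; lia).
Qed.

(** A stage adds at most two formulas to the previous one, so starting from closed formulas it never
    exhausts the variables and a fresh one can always be chosen. *)
Lemma stage_bounded k : exists n, forall q, stage k q -> bounded n q.
Proof.
  induction k as [|k [n IH]]; [exists 0; exact A0_closed|].
  destruct (bounded_ex (enum k)) as [m Hm].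
  cbn. unfold extend.
  destruct (classic (exists p', enum k = Imp (All p') Bot)) as [[p' Hp]|Hp].
  - destruct (bounded_ex (Imp (inst p' (epsilon (inhabits 0) (fresh (stage k) p'))) Bot))
      as [l Hl].
    exists (n + m + l). intros q [Hq|[_ [->|[p'' [Hp'' ->]]]]].
    + eapply bounded_mono; [|eauto]; lia.
    + eapply bounded_mono; [|eauto]; lia.
    + rewrite Hp in Hp''. injection Hp'' as <-. eapply bounded_mono; [|eauto]; lia.
  - exists (n + m). intros q [Hq|[_ [->|[p'' [Hp'' ->]]]]].
    + eapply bounded_mono; [|eauto]; lia.
    + eapply bounded_mono; [|eauto]; lia.
    + exfalso; eauto.
Qed.

Lemma stage_mono k l q : k <= l -> stage k q -> stage l q.
Proof. induction 1; auto. intro Hq. left. auto. Qed.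

Lemma stage_consistent k : consistent (stage k).
Proof.
  induction k as [|k IH]; [exact A0_consistent|].
  destruct (classic (consistent (with_axiom (stage k) (enum k)))) as [Hc|Hc].
  2: { intro H. apply IH. revert H. apply provable_mono. intros q [|[]]; tauto. }
  destruct (classic (exists p', enum k = Imp (All p') Bot)) as [[p Hp]|Hp].
  2: { intro H. apply Hc. revert H. apply provable_mono.
       intros q [Hq|[_ [->|[p [Hp' _]]]]]; [now left|now right|exfalso; eauto]. }
  destruct (stage_bounded k) as [n Hn].
  destruct (fresh_ex _ p n Hn) as [H1 H2].
  set (m := epsilon (inhabits 0) (fresh (stage k) p)) in *.
  intro H. apply Hc.
  (* If the refuted instance caused the inconsistency, the negated universal alone would prove the
     instance at [m]. As [m] is fresh, generalization then yields [All p], against the consistency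
     of [enum k] with the stage. *)
  assert (HD : provable (with_axiom (stage k) (enum k)) (inst p m)).
  { apply provable_raa. intro Hc'. apply Hc'. revert H. apply provable_mono.
    intros q [Hq|[_ [->|[p' [Hp' ->]]]]]; [left; now left|left; now right|].
    rewrite Hp in Hp'. injection Hp' as <-. now right. }
  apply provable_impE with (All p).
  - apply provable_hyp. right. auto.
  - destruct HD as (G & HG & D). exists G. split; auto.
    apply derives_generalize with m; auto.
    intros q Hq. destruct (HG q Hq) as [Hs| ->]; auto.
    rewrite Hp. split; cbn; auto.
Qed.

Lemma limit_consistent : consistent limit.
Proof.
  intros (G & HG & D).
  assert (H : exists k, forall q, In q G -> stage k q).
  { clear D. induction G as [|a G IH]; [exists 0; intros q []|].
    destruct IH as [k Hk]; [intros; apply HG; now right|].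
    destruct (HG a (or_introl eq_refl)) as [l Hl]. exists (k + l).
    intros q [<-|Hq]; [apply (stage_mono l)|apply (stage_mono k)]; auto; lia. }
  destruct H as [k Hk]. apply (stage_consistent k). now exists G.
Qed.

(** Looks at the moment when [p] has its turn. Rejection there means that an early stage refutes
    [p], and the limit inherits the refutation; closure under provability and maximality both
    follow. *)
Lemma limit_stage p : limit p \/ ~ consistent (with_axiom (stage (code p)) p).
Proof.
  destruct (classic (consistent (with_axiom (stage (code p)) p))) as [H|H]; auto.
  left. exists (S (code p)). right. rewrite enum_code. auto.
Qed.

Lemma limit_closed p : provable limit p -> limit p.
Proof.
  intro H. destruct (limit_stage p) as [|Hc]; auto. exfalso.
  apply limit_consistent. apply provable_impE with p; auto.
  apply provable_not in Hc. revert Hc. apply provable_mono.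
  intros q Hq. now exists (code p).
Qed.

Lemma limit_max p : ~ limit p -> limit (Imp p Bot).
Proof.
  intro H. destruct (limit_stage p) as [|Hc]; [tauto|].
  apply limit_closed. apply provable_not in Hc. revert Hc. apply provable_mono.
  intros q Hq. now exists (code p).
Qed.

Lemma limit_impE p q : limit (Imp p q) -> limit p -> limit q.
Proof.
  intros H1 H2. apply limit_closed. apply provable_impE with p; now apply provable_hyp.
Qed.

Lemma limit_rule p q : (forall G, derives G p -> derives G q) -> limit p -> limit q.
Proof.
  intros H Hp. apply limit_closed. apply provable_rule with p; auto.
  now apply provable_hyp.
Qed.

Lemma limit_not_bot : ~ limit Bot.
Proof. intro H. apply limit_consistent. now apply provable_hyp. Qed.

Lemma limit_imp p q : limit (Imp p q) <-> (limit p -> limit q).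
Proof.
  split; [apply limit_impE|]. intro H.
  destruct (classic (limit q)) as [Hq|Hq].
  - revert Hq. apply limit_rule. intros G D. apply d_impI.
    eapply derives_weaken; eauto using incl_tl, incl_refl.
  - assert (Hp : limit (Imp p Bot)) by (apply limit_max; tauto).
    revert Hp. apply limit_rule. intros G D. apply d_impI, d_raa.
    eapply d_impE; [eapply derives_weaken; [exact D|]|apply d_hyp; right; now left].
    intros x Hx; right; now right.
Qed.

Lemma limit_witness p : ~ limit (All p) -> exists t, ~ limit (inst p t).
Proof.
  intro H. apply limit_max in H.
  destruct (limit_stage (Imp (All p) Bot)) as [_|Hc].
  2: { exfalso. apply limit_consistent. apply provable_impE with (Imp (All p) Bot).
       - apply provable_not in Hc. revert Hc. apply provable_mono.
         intros q Hq. now exists (code (Imp (All p) Bot)).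
       - now apply provable_hyp. }
  set (k := code (Imp (All p) Bot)).
  exists (epsilon (inhabits 0) (fresh (stage k) p)). intro Hi.
  apply limit_not_bot.
  apply limit_impE with (inst p (epsilon (inhabits 0) (fresh (stage k) p))); auto.
  exists (S k). right. split.
  - unfold k. rewrite enum_code. intro Hc. apply limit_consistent.
    destruct Hc as (G & HG & D). exists G. split; auto.
    intros q Hq. destruct (HG q Hq) as [| ->]; auto. now exists k.
  - right. exists p. split; auto. unfold k. now rewrite enum_code.
Qed.

Definition eqv (i j : nat) : Prop := limit (Eq i j).

Lemma limit_subst p i j : eqv i j -> limit (inst p i) -> limit (inst p j).
Proof.
  intros H1 H2. apply limit_closed.
  destruct (provable_hyp _ _ H1) as (G & HG & D).
  destruct (provable_hyp _ _ H2) as (G' & HG' & D').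
  exists (G ++ G'). split.
  - intros r Hr. apply in_app_iff in Hr as [|]; auto.
  - eapply d_eq_subst; eapply derives_weaken; eauto using incl_appl, incl_appr, incl_refl.
Qed.

Lemma eqv_refl i : eqv i i.
Proof. apply limit_closed. exists []. split; [intros q []|apply d_eq_refl]. Qed.

Lemma eqv_sym i j : eqv i j -> eqv j i.
Proof. intro H. apply (limit_subst (Eq 0 (S i)) i j H), eqv_refl. Qed.

Lemma eqv_trans i j k : eqv i j -> eqv j k -> eqv i k.
Proof. intros H1 H2. apply (limit_subst (Eq (S i) 0) j k H2), H1. Qed.

(** Satisfaction reads [Eq] as equality of Rocq, so provably equal variables have to be identified;
    a chosen representative of each class replaces the quotient. *)
Definition rep (i : nat) : nat := epsilon (inhabits 0) (eqv i).

Lemma rep_eqv i : eqv i (rep i).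
Proof. apply (epsilon_spec (inhabits 0) (eqv i)). exists i. apply eqv_refl. Qed.

(** Equivalent variables have extensionally equal classes, hence equal ones, and epsilon depends
    only on the predicate it is given. *)
Lemma rep_eq i j : eqv i j -> rep i = rep j.
Proof.
  intro H. unfold rep. f_equal. apply functional_extensionality. intro k.
  apply propositional_extensionality. split; intro Hk; eapply eqv_trans; eauto.
  now apply eqv_sym.
Qed.

Definition term_model : Type := {i : nat | rep i = i}.

Definition point (i : nat) : term_model :=
  exist _ (rep i) (eq_sym (rep_eq _ _ (rep_eqv i))).

Definition term_mem (a b : term_model) : Prop := limit (Mem (proj1_sig a) (proj1_sig b)).

End Henkin.

(** * Satisfaction and the completeness theorem *)

Fixpoint sat {M : Type} (E : M -> M -> Prop) (s : nat -> M) (p : form) : Prop :=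
  match p with
  | Mem i j => E (s i) (s j)
  | Eq i j => s i = s j
  | Bot => False
  | Imp p q => sat E s p -> sat E s q
  | All p => forall a, sat E (scons a s) p
  end.

Lemma term_model_truth A0 (H : consistent A0) (Hc : forall q, A0 q -> bounded 0 q) p :
  forall s : nat -> term_model A0,
  sat (term_mem A0) s p <-> limit A0 (ren (fun i => proj1_sig (s i)) p).
Proof.
  induction p; intro s; cbn.
  - reflexivity.
  - split.
    + intros ->. now apply eqv_refl.
    + intro He. apply rep_eq in He; auto. destruct (s i) as [x Hx], (s j) as [y Hy].
      cbn in *. rewrite Hx, Hy in He. subst y. f_equal. apply proof_irrelevance.
  - split; [tauto|]. now apply limit_not_bot.
  - rewrite limit_imp by auto. now rewrite IHp1, IHp2.
  - set (q := ren _ p).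
    assert (Hq : forall a, ren (fun i => proj1_sig (scons a s i)) p = inst q (proj1_sig a)).
    { intro a. unfold inst, q. rewrite ren_comp. apply ren_ext. now intros [|i]. }
    split.
    + intro Ha. apply NNPP. intro Hn. apply limit_witness in Hn as [t Ht]; auto.
      (* The counterexample [t] need not be a representative. The hypothesis speaks of the element
         [point t], that is of [rep t], and substitution carries the instance back to [t]. *)
      apply Ht. apply (limit_subst A0 Hc H q (rep A0 t) t).
      * apply eqv_sym, rep_eqv; auto.
      * specialize (Ha (point A0 Hc H t)). now rewrite IHp, Hq in Ha.
    + intros Ha a. rewrite IHp, Hq. revert Ha. apply limit_rule; auto.
      intros G D. now apply d_allE.
Qed.

(** If [p] were not provable, the term model of [T] together with the negation of [p] would satisfy
    both. Its formulas are closed, so a constant assignment serves to evaluate them. *)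
Theorem completeness (T : form -> Prop) (p : form) :
  (forall q, T q -> bounded 0 q) -> bounded 0 p ->
  (forall (M : Type) (E : M -> M -> Prop) (s : nat -> M),
     (forall q, T q -> sat E s q) -> sat E s p) ->
  provable T p.
Proof.
  intros HT Hp Hv. apply provable_raa. intro Hc.
  assert (Hb : forall q, with_axiom T (Imp p Bot) q -> bounded 0 q).
  { intros q [Hq| ->]; [auto|split; cbn; auto]. }
  set (A0 := with_axiom T (Imp p Bot)) in *.
  assert (Ht : forall q, A0 q -> sat (term_mem A0) (fun _ => point A0 Hb Hc 0) q).
  { intros q Hq. apply term_model_truth; auto. rewrite ren_closed by auto. now exists 0. }
  apply (Ht (Imp p Bot)).
  - now right.
  - apply Hv. intros q Hq. apply Ht. now left.
Qed.

Lemma sat_ren {M} (E : M -> M -> Prop) p : forall s r,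
  sat E s (ren r p) <-> sat E (fun i => s (r i)) p.
Proof.
  induction p; intros s r; cbn; try reflexivity.
  - now rewrite IHp1, IHp2.
  - assert (Hx : forall a, (fun i => scons a s (up r i)) = scons a (fun i => s (r i))).
    { intro a. apply functional_extensionality. now intros [|i]. }
    split; intros H a; specialize (H a); fold (up r) in *;
      rewrite IHp, Hx in *; exact H.
Qed.

Lemma sat_bounded {M} (E : M -> M -> Prop) p n s s' : bounded n p ->
  (forall i, i < n -> s i = s' i) -> sat E s p <-> sat E s' p.
Proof.
  revert n s s'. induction p; intros n s s' Hb H; cbn in *.
  - destruct Hb; now rewrite !H.
  - destruct Hb; now rewrite !H.
  - reflexivity.
  - destruct Hb. rewrite (IHp1 n s s'), (IHp2 n s s'); auto; reflexivity.
  - split; intros H' a; specialize (H' a);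
      [rewrite <- (IHp (S n) (scons a s))|rewrite (IHp (S n) _ (scons a s'))]; eauto;
      intros [|i] Hi; cbn; auto; apply H; lia.
Qed.

(** * Formulas with level variables in a structure *)

(** A level keeps its value when further quantifiers are entered, whereas its index changes. Stating
    environments by levels lets [look_there] carry facts under binders. *)
Definition look {M : Type} (s : nat -> M) (d : nat) (x : var) (a : M) : Prop :=
  x < d /\ s (index d x) = a.

Lemma look_here {M} (s : nat -> M) d a : look (scons a s) (S d) d a.
Proof. split; [lia|]. unfold index. now rewrite Nat.sub_diag. Qed.

Lemma look_there {M} (s : nat -> M) d x a b : look s d x b -> look (scons a s) (S d) x b.
Proof.
  intros [H1 H2]. split; [lia|]. unfold index in *.
  replace (S d - S x) with (S (d - S x)) by lia. exact H2.
Qed.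

Section Translation.
Context {M : Type} (E : M -> M -> Prop).

Lemma tr_mem s d x y a b : look s d x a -> look s d y b ->
  sat E s (fm_mem x y d) <-> E a b.
Proof. intros [_ <-] [_ <-]. reflexivity. Qed.

Lemma tr_eq s d x y a b : look s d x a -> look s d y b ->
  sat E s (fm_eq x y d) <-> a = b.
Proof. intros [_ <-] [_ <-]. reflexivity. Qed.

Lemma tr_imp s d p q P Q : (sat E s (p d) <-> P) -> (sat E s (q d) <-> Q) ->
  sat E s (fm_imp p q d) <-> (P -> Q).
Proof. cbn. tauto. Qed.

Lemma tr_not s d p P : (sat E s (p d) <-> P) -> sat E s (fm_not p d) <-> ~ P.
Proof. cbn. tauto. Qed.

Lemma tr_and s d p q P Q : (sat E s (p d) <-> P) -> (sat E s (q d) <-> Q) ->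
  sat E s (fm_and p q d) <-> P /\ Q.
Proof. cbn. tauto. Qed.

Lemma tr_or s d p q P Q : (sat E s (p d) <-> P) -> (sat E s (q d) <-> Q) ->
  sat E s (fm_or p q d) <-> P \/ Q.
Proof. cbn. tauto. Qed.

Lemma tr_iff s d p q P Q : (sat E s (p d) <-> P) -> (sat E s (q d) <-> Q) ->
  sat E s (fm_iff p q d) <-> (P <-> Q).
Proof. cbn. tauto. Qed.

Lemma tr_all s d p (P : M -> Prop) :
  (forall a, sat E (scons a s) (p d (S d)) <-> P a) ->
  sat E s (fm_all p d) <-> forall a, P a.
Proof. intro H. split; intros H' a; apply H, H'. Qed.

Lemma tr_ex s d p (P : M -> Prop) :
  (forall a, sat E (scons a s) (p d (S d)) <-> P a) ->
  sat E s (fm_ex p d) <-> exists a, P a.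
Proof.
  intro H. split.
  - intro H'. apply NNPP. intro Hn. apply H'. intros a Ha. apply Hn. exists a. now apply H.
  - intros [a Ha] H'. apply (H' a), H, Ha.
Qed.

End Translation.

Create HintDb tr discriminated.
Hint Constants Opaque : tr.
Hint Resolve look_here look_there tr_mem tr_eq : tr.

(** Only connectives and quantifiers are decomposed. A named predicate is left to its own
    translation lemma: constants are opaque in the hint database, so it is not unfolded to a raw
    formula. *)
Ltac tr := intros;
  lazymatch goal with
  | |- sat _ _ (fm_imp _ _ _) <-> _ => apply tr_imp; tr
  | |- sat _ _ (fm_not _ _) <-> _ => apply tr_not; tr
  | |- sat _ _ (fm_and _ _ _) <-> _ => apply tr_and; tr
  | |- sat _ _ (fm_or _ _ _) <-> _ => apply tr_or; tr
  | |- sat _ _ (fm_iff _ _ _) <-> _ => apply tr_iff; tr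
  | |- sat _ _ (fm_all _ _) <-> _ => apply tr_all; tr
  | |- sat _ _ (fm_ex _ _) <-> _ => apply tr_ex; tr
  | |- _ => eauto 20 with tr
  end.

(** * Semantic readings of the set-theoretic formulas *)

Section Predicates.
Context {M : Type} (E : M -> M -> Prop).

Definition Empty x := forall z, ~ E z x.
Definition Sub x y := forall z, E z x -> E z y.
Definition Upair p a b := forall z, E z p <-> z = a \/ z = b.
Definition Union u c := forall z, E z u <-> exists y, E y c /\ E z y.
Definition Power p x := forall z, E z p <-> Sub z x.
Definition Succ s n := forall z, E z s <-> E z n \/ z = n.
Definition Inductive_set w :=
  (exists e, Empty e /\ E e w) /\ (forall n, E n w -> exists s, Succ s n /\ E s w).
Definition Pair p a b := exists s t, Upair s a a /\ Upair t a b /\ Upair p s t.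
Definition Maps_to f a b := exists p, Pair p a b /\ E p f.
Definition Function f x y :=
  (forall p, E p f -> exists a b, E a x /\ E b y /\ Pair p a b) /\
  (forall a, E a x -> exists b, Maps_to f a b /\ forall b', Maps_to f a b' -> b' = b).
Definition Bijection f x y :=
  Function f x y /\
  (forall a a' b, Maps_to f a b -> Maps_to f a' b -> a = a') /\
  (forall b, E b y -> exists a, Maps_to f a b).
Definition Equipotent x y := exists f, Bijection f x y.
Definition Omega w := Inductive_set w /\ forall v, Inductive_set v -> Sub w v.
Definition Finite x := exists w n, Omega w /\ E n w /\ Equipotent x n.
Definition Denumerable x := exists w, Omega w /\ Equipotent x w.
Definition Finite_subsets f x := forall z, E z f <-> Sub z x /\ Finite z.
Definition Inter2 w u v := forall z, E z w <-> E z u /\ E z v.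
Definition Diff w u v := forall z, E z w <-> E z u /\ ~ E z v.
Definition Topology x t :=
  (forall u, E u t -> Sub u x) /\
  (forall e, Empty e -> E e t) /\
  E x t /\
  (forall c u, Sub c t -> Union u c -> E u t) /\
  (forall u v w, E u t -> E v t -> Inter2 w u v -> E w t).
Definition Discrete_space x t := Topology x t /\ Power t x.
Definition Clopen x t u := E u t /\ exists c, Diff c x u /\ E c t.
Definition Cellular_family t c :=
  (forall u, E u c -> E u t /\ ~ Empty u) /\
  (forall u v, E u c -> E v c -> ~ u = v -> ~ exists z, E z u /\ E z v).
Definition Clopen_matrix x t m :=
  exists w y, Omega w /\ Function m w y /\
    (forall i j c c', E i w -> E j w -> ~ i = j ->
       Maps_to m i c -> Maps_to m j c' -> ~ c = c') /\
    (forall n c, E n w -> Maps_to m n c ->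
       Finite c /\ Cellular_family t c /\
       (forall u, E u c -> Clopen x t u) /\ Union x c).
Definition IQDI :=
  forall x, ~ Finite x ->
    exists p f, Power p x /\ Finite_subsets f p /\
      exists d, Sub d f /\ Denumerable d.
Definition Discrete_matrices :=
  forall x t, Discrete_space x t -> ~ Finite x -> exists m, Clopen_matrix x t m.

Lemma tr_empty s d x a : look s d x a ->
  sat E s (is_empty x d) <-> Empty a.
Proof. unfold is_empty, Empty; tr. Qed.
Hint Resolve tr_empty : tr.
Lemma tr_sub s d x y a b : look s d x a -> look s d y b ->
  sat E s (subset x y d) <-> Sub a b.
Proof. unfold subset, Sub; tr. Qed.
Hint Resolve tr_sub : tr.
Lemma tr_upair s d x y z a b c : look s d x a -> look s d y b -> look s d z c ->
  sat E s (is_upair x y z d) <-> Upair a b c.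
Proof. unfold is_upair, Upair; tr. Qed.
Hint Resolve tr_upair : tr.
Lemma tr_union s d x y a b : look s d x a -> look s d y b ->
  sat E s (is_union x y d) <-> Union a b.
Proof. unfold is_union, Union; tr. Qed.
Hint Resolve tr_union : tr.
Lemma tr_power s d x y a b : look s d x a -> look s d y b ->
  sat E s (is_power x y d) <-> Power a b.
Proof. unfold is_power, Power; tr. Qed.
Hint Resolve tr_power : tr.
Lemma tr_succ s d x y a b : look s d x a -> look s d y b ->
  sat E s (is_succ x y d) <-> Succ a b.
Proof. unfold is_succ, Succ; tr. Qed.
Hint Resolve tr_succ : tr.
Lemma tr_inductive s d x a : look s d x a ->
  sat E s (inductive_set x d) <-> Inductive_set a.
Proof. unfold inductive_set, Inductive_set; tr. Qed.
Hint Resolve tr_inductive : tr.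
Lemma tr_pair s d x y z a b c : look s d x a -> look s d y b -> look s d z c ->
  sat E s (is_pair x y z d) <-> Pair a b c.
Proof. unfold is_pair, Pair; tr. Qed.
Hint Resolve tr_pair : tr.
Lemma tr_maps_to s d x y z a b c : look s d x a -> look s d y b -> look s d z c ->
  sat E s (maps_to x y z d) <-> Maps_to a b c.
Proof. unfold maps_to, Maps_to; tr. Qed.
Hint Resolve tr_maps_to : tr.
Lemma tr_function s d x y z a b c : look s d x a -> look s d y b -> look s d z c ->
  sat E s (is_function x y z d) <-> Function a b c.
Proof. unfold is_function, Function; tr. Qed.
Hint Resolve tr_function : tr.
Lemma tr_bijection s d x y z a b c : look s d x a -> look s d y b -> look s d z c ->
  sat E s (is_bijection x y z d) <-> Bijection a b c.
Proof. unfold is_bijection, Bijection; tr. Qed.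
Hint Resolve tr_bijection : tr.
Lemma tr_equipotent s d x y a b : look s d x a -> look s d y b ->
  sat E s (equipotent x y d) <-> Equipotent a b.
Proof. unfold equipotent, Equipotent; tr. Qed.
Hint Resolve tr_equipotent : tr.
Lemma tr_omega s d x a : look s d x a ->
  sat E s (is_omega x d) <-> Omega a.
Proof. unfold is_omega, Omega; tr. Qed.
Hint Resolve tr_omega : tr.
Lemma tr_finite s d x a : look s d x a ->
  sat E s (finite x d) <-> Finite a.
Proof. unfold finite, Finite; tr. Qed.
Hint Resolve tr_finite : tr.
Lemma tr_denumerable s d x a : look s d x a ->
  sat E s (denumerable x d) <-> Denumerable a.
Proof. unfold denumerable, Denumerable; tr. Qed.
Hint Resolve tr_denumerable : tr.
Lemma tr_finite_subsets s d x y a b : look s d x a -> look s d y b ->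
  sat E s (is_finite_subsets x y d) <-> Finite_subsets a b.
Proof. unfold is_finite_subsets, Finite_subsets; tr. Qed.
Hint Resolve tr_finite_subsets : tr.
Lemma tr_inter2 s d x y z a b c : look s d x a -> look s d y b -> look s d z c ->
  sat E s (is_inter2 x y z d) <-> Inter2 a b c.
Proof. unfold is_inter2, Inter2; tr. Qed.
Hint Resolve tr_inter2 : tr.
Lemma tr_diff s d x y z a b c : look s d x a -> look s d y b -> look s d z c ->
  sat E s (is_diff x y z d) <-> Diff a b c.
Proof. unfold is_diff, Diff; tr. Qed.
Hint Resolve tr_diff : tr.
Lemma tr_topology s d x y a b : look s d x a -> look s d y b ->
  sat E s (is_topology x y d) <-> Topology a b.
Proof. unfold is_topology, Topology; tr. Qed.
Hint Resolve tr_topology : tr.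
Lemma tr_discrete s d x y a b : look s d x a -> look s d y b ->
  sat E s (is_discrete_space x y d) <-> Discrete_space a b.
Proof. unfold is_discrete_space, Discrete_space; tr. Qed.
Hint Resolve tr_discrete : tr.
Lemma tr_clopen s d x y z a b c : look s d x a -> look s d y b -> look s d z c ->
  sat E s (is_clopen x y z d) <-> Clopen a b c.
Proof. unfold is_clopen, Clopen; tr. Qed.
Hint Resolve tr_clopen : tr.
Lemma tr_cellular s d x y a b : look s d x a -> look s d y b ->
  sat E s (is_cellular_family x y d) <-> Cellular_family a b.
Proof. unfold is_cellular_family, Cellular_family; tr. Qed.
Hint Resolve tr_cellular : tr.
Lemma tr_matrix s d x y z a b c : look s d x a -> look s d y b -> look s d z c ->
  sat E s (is_clopen_matrix x y z d) <-> Clopen_matrix a b c.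
Proof. unfold is_clopen_matrix, Clopen_matrix; tr. Qed.
Hint Resolve tr_matrix : tr.

Lemma tr_main s : sat E s
  (sentence (fm_iff IQDI_P infinite_discrete_spaces_admit_clopen_matrices))
  <-> (IQDI <-> Discrete_matrices).
Proof.
  unfold sentence, IQDI_P, infinite_discrete_spaces_admit_clopen_matrices, infinite,
    IQDI, Discrete_matrices; tr.
Qed.
End Predicates.

Hint Resolve tr_empty tr_sub tr_upair tr_union tr_power tr_succ tr_inductive
  tr_pair tr_maps_to tr_function tr_bijection tr_equipotent tr_omega tr_finite
  tr_denumerable tr_finite_subsets tr_inter2 tr_diff tr_topology tr_discrete
  tr_clopen tr_cellular tr_matrix : tr.

(** * Universal closures and schemas in a structure *)

Fixpoint prepend {M : Type} (n : nat) (v s : nat -> M) : nat -> M :=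
  match n with O => s | S n => scons (v n) (prepend n v s) end.

(** The outermost quantifier of a closure binds level 0, so the value [v j] of parameter [j] is
    found at level [j], as the schemas expect. *)
Lemma look_prepend {M} (v s : nat -> M) n j : j < n -> look (prepend n v s) n j (v j).
Proof.
  induction n as [|n IH]; intro H; [lia|]. cbn.
  destruct (Nat.eq_dec j n) as [->|]; [apply look_here|].
  apply look_there, IH. lia.
Qed.

Lemma sat_iter_all {M} (E : M -> M -> Prop) n v s : forall p,
  sat E s (Nat.iter n All p) -> sat E (prepend n v s) p.
Proof.
  induction n as [|n IH]; intros p H; [exact H|].
  rewrite Nat.iter_succ_r in H. apply IH in H. apply H.
Qed.

Lemma tr_schema1 {M} (E : M -> M -> Prop) s d n p (v : nat -> M) x a :
  bounded (1 + n) p -> look s d x a -> (forall j, j < n -> look s d j (v j)) ->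
  sat E s (schema1 p x d) <-> sat E (scons a v) p.
Proof.
  intros Hp [_ Hx] Hv. unfold schema1. rewrite sat_ren.
  apply sat_bounded with (1 + n); auto.
  intros [|j] Hj; [exact Hx|]. apply (Hv j). lia.
Qed.

Lemma tr_schema2 {M} (E : M -> M -> Prop) s d n p (v : nat -> M) x y a b :
  bounded (2 + n) p -> look s d x a -> look s d y b ->
  (forall j, j < n -> look s d j (v j)) ->
  sat E s (schema2 p x y d) <-> sat E (scons a (scons b v)) p.
Proof.
  intros Hp [_ Hx] [_ Hy] Hv. unfold schema2. rewrite sat_ren.
  apply sat_bounded with (2 + n); auto.
  intros [|[|j]] Hj; [exact Hx|exact Hy|]. apply (Hv j). lia.
Qed.

(** * Definable predicates *)

Section Definability.
Context {M : Type} (E : M -> M -> Prop).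

(* A formula with parameters is a formula together with a map [r] sending each
   variable to an argument ([inl]) or a parameter ([inr]). *)
Definition assign (r : nat -> nat + M) (s : nat -> M) (i : nat) : M :=
  match r i with inl j => s j | inr c => c end.

Definition definable (P : (nat -> M) -> Prop) : Prop :=
  exists p r, forall s, P s <-> sat E (assign r s) p.

Lemma definable_ext P Q : (forall s, P s <-> Q s) -> definable P -> definable Q.
Proof. intros H (p & r & Hp). exists p, r. intro s. now rewrite <- H. Qed.

Lemma definable_ren P (g : nat -> nat) :
  definable P -> definable (fun s => P (fun i => s (g i))).
Proof.
  intros (p & r & H).
  exists p, (fun i => match r i with inl j => inl (g j) | inr c => inr c end).
  intro s. rewrite H.
  replace (assign r (fun i => s (g i))) with
    (assign (fun i => match r i with inl j => inl (g j) | inr c => inr c end) s);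
    [reflexivity|].
  apply functional_extensionality. intro i. unfold assign. now destruct (r i).
Qed.

Lemma definable_bot : definable (fun _ => False).
Proof. exists Bot, inl. intro s; reflexivity. Qed.

Lemma definable_mem_var i j : definable (fun s => E (s i) (s j)).
Proof. exists (Mem i j), inl. intro s; reflexivity. Qed.

Lemma definable_eq_var i j : definable (fun s => s i = s j).
Proof. exists (Eq i j), inl. intro s; reflexivity. Qed.

Lemma definable_eq_const i c : definable (fun s => s i = c).
Proof.
  exists (Eq 0 1), (scons (inl i) (fun _ => inr c)). intro s; reflexivity.
Qed.

(** The two formulas come with separate maps to arguments and parameters. Moving one formula to the
    even variables and the other to the odd ones lets a single map serve both. *)
Lemma definable_imp P Q : definable P -> definable Q -> definable (fun s => P s -> Q s).
Proof.
  intros (p & r & Hp) (q & t & Hq).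
  exists (Imp (ren (fun i => 2 * i) p) (ren (fun i => S (2 * i)) q)),
    (fun i => if Nat.even i then r (i / 2) else t (i / 2)).
  intro s. cbn [sat]. rewrite !sat_ren, Hp, Hq.
  match goal with |- (sat _ ?a _ -> sat _ ?b _) <-> (sat _ ?c _ -> sat _ ?d _) =>
    replace c with a; [replace d with b; [reflexivity|]|] end;
    apply functional_extensionality; intro i; unfold assign.
  - replace (S (2 * i)) with (2 * i + 1) by lia.
    rewrite Nat.even_odd. replace (2 * i + 1) with (1 + i * 2) by lia.
    now rewrite Nat.div_add by lia.
  - rewrite Nat.even_even. replace (2 * i) with (i * 2) by lia.
    now rewrite Nat.div_mul by lia.
Qed.

(** Variables that read argument 0 become the bound variable; all others are shifted past it, and
    the remaining arguments move down by one. *)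
Lemma definable_all (P : M -> (nat -> M) -> Prop) :
  definable (fun s => P (s 0) (fun i => s (S i))) -> definable (fun s => forall x, P x s).
Proof.
  intros (p & r & H).
  set (g := fun i => match r i with inl 0 => 0 | _ => S i end).
  set (r' := fun i => match r i with inl j => inl (pred j) | inr c => inr c end).
  exists (All (ren g p)), r'. intro s. cbn [sat].
  assert (Hx : forall x, P x s <-> sat E (scons x (assign r' s)) (ren g p)).
  { intro x. rewrite sat_ren.
    replace (fun i => scons x (assign r' s) (g i)) with (assign r (scons x s)).
    - rewrite <- H. cbn. reflexivity.
    - apply functional_extensionality. intro i. unfold assign, g, r'.
      destruct (r i) as [[|j]|c] eqn:Hi; cbn; rewrite ?Hi; reflexivity. }
  split; intros H' x; apply Hx, H'.
Qed.

Lemma definable_not P : definable P -> definable (fun s => ~ P s).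
Proof. intro H. exact (definable_imp _ _ H definable_bot). Qed.

Lemma definable_and P Q : definable P -> definable Q -> definable (fun s => P s /\ Q s).
Proof.
  intros HP HQ. apply definable_ext with (fun s => ~ (P s -> ~ Q s)); [intro; tauto|].
  apply definable_not, definable_imp; [|apply definable_not]; assumption.
Qed.

Lemma definable_or P Q : definable P -> definable Q -> definable (fun s => P s \/ Q s).
Proof.
  intros HP HQ. apply definable_ext with (fun s => ~ P s -> Q s); [intro; tauto|].
  apply definable_imp; [apply definable_not|]; assumption.
Qed.

Lemma definable_iff P Q : definable P -> definable Q -> definable (fun s => P s <-> Q s).
Proof. intros HP HQ. apply definable_and; apply definable_imp; assumption. Qed.

Lemma definable_ex (P : M -> (nat -> M) -> Prop) :
  definable (fun s => P (s 0) (fun i => s (S i))) -> definable (fun s => exists x, P x s).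
Proof.
  intro H. apply definable_ext with (fun s => ~ forall x, ~ P x s).
  { intro s. split; [apply not_all_not_ex|]. intros [x Hx] Hn. now apply (Hn x). }
  apply definable_not, definable_all with (P := fun x s => ~ P x s), definable_not, H.
Qed.

(** The language has no function symbols, so a term enters formulas through its graph, with the
    value in position 0. *)
Definition definable_term (t : (nat -> M) -> M) : Prop :=
  definable (fun s => s 0 = t (fun i => s (S i))).

Lemma definable_term_var i : definable_term (fun s => s i).
Proof. apply (definable_eq_var 0 (S i)). Qed.

Lemma definable_term_const c : definable_term (fun _ => c).
Proof. apply (definable_eq_const 0 c). Qed.

Lemma definable_subst (P : M -> (nat -> M) -> Prop) t : definable_term t ->
  definable (fun s => P (s 0) (fun i => s (S i))) -> definable (fun s => P (t s) s).
Proof.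
  intros Ht HP. apply definable_ext with (fun s => exists x, x = t s /\ P x s).
  { intro s. split; [now intros (x & -> & Hx)|eauto]. }
  apply definable_ex, definable_and; assumption.
Qed.

Lemma definable_term_ren t (g : nat -> nat) :
  definable_term t -> definable_term (fun s => t (fun i => s (g i))).
Proof. intro H. exact (definable_ren _ (scons 0 (fun i => S (g i))) H). Qed.

Definition definable1 (P : M -> Prop) := definable (fun s => P (s 0)).
Definition definable2 (P : M -> M -> Prop) := definable (fun s => P (s 0) (s 1)).
Definition definable3 (P : M -> M -> M -> Prop) := definable (fun s => P (s 0) (s 1) (s 2)).
Definition definable_fun1 (f : M -> M) := definable_term (fun s => f (s 0)).
Definition definable_fun2 (f : M -> M -> M) := definable_term (fun s => f (s 0) (s 1)).

Lemma definable1_app P a : definable1 P -> definable_term a -> definable (fun s => P (a s)).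
Proof.
  intros HP Ha. apply (definable_subst (fun x _ => P x)); auto.
Qed.

Lemma definable2_app P a b :
  definable2 P -> definable_term a -> definable_term b -> definable (fun s => P (a s) (b s)).
Proof.
  intros HP Ha Hb. apply (definable_subst (fun x s => P x (b s))); auto.
  apply (definable_subst (fun y s => P (s 0) y) (fun s => b (fun i => s (S i)))).
  - now apply definable_term_ren.
  - apply (definable_ren _ (fun i => match i with 0 => 1 | _ => 0 end) HP).
Qed.

Lemma definable3_app P a b c :
  definable3 P -> definable_term a -> definable_term b -> definable_term c ->
  definable (fun s => P (a s) (b s) (c s)).
Proof.
  intros HP Ha Hb Hc. apply (definable_subst (fun x s => P x (b s) (c s))); auto.
  apply (definable_subst (fun y s => P (s 0) y (c (fun i => s (S i))))
    (fun s => b (fun i => s (S i)))).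
  { now apply definable_term_ren. }
  apply (definable_subst (fun z s => P (s 1) (s 0) z) (fun s => c (fun i => s (S (S i))))).
  { now apply (definable_term_ren c (fun i => S (S i))). }
  apply (definable_ren _ (fun i => match i with 0 => 2 | 1 => 1 | _ => 0 end) HP).
Qed.

Lemma definable2_mem : definable2 E.
Proof. apply definable_mem_var. Qed.

Lemma definable2_eq : definable2 eq.
Proof. apply definable_eq_var. Qed.

Lemma definable_fun1_app f a :
  definable_fun1 f -> definable_term a -> definable_term (fun s => f (a s)).
Proof.
  intros Hf Ha. apply (definable_subst (fun x s => s 0 = f x) (fun s => a (fun i => s (S i)))).
  - now apply definable_term_ren.
  - apply (definable_ren _ (fun i => match i with 0 => 1 | _ => 0 end) Hf).
Qed.

Lemma definable_fun2_app f a b :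
  definable_fun2 f -> definable_term a -> definable_term b ->
  definable_term (fun s => f (a s) (b s)).
Proof.
  intros Hf Ha Hb.
  apply (definable3_app (fun x y z => x = f y z));
    auto using definable_term_ren, definable_term_var.
Qed.

End Definability.

(** * Set theory inside a model of ZF *)

Section Model.
Context {M : Type} (E : M -> M -> Prop) (s0 : nat -> M).
Hypothesis model_ZF : forall q, ZF q -> sat E s0 q.

Lemma ext x y : (forall z, E z x <-> E z y) -> x = y.
Proof.
  (* The right-hand side of the equivalence is unified with the goal; [tr] then checks that the
     axiom expresses it. The other single axioms are read off in the same way. *)
  revert x y. refine (proj1 (_ : sat E s0 (sentence ax_extensionality) <-> _)
    (model_ZF _ ZF_extensionality)).
  unfold sentence, ax_extensionality; tr.
Qed.

Lemma foundation x : (exists y, E y x) -> exists y, E y x /\ ~ exists z, E z x /\ E z y.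
Proof.
  revert x. refine (proj1 (_ : sat E s0 (sentence ax_foundation) <-> _)
    (model_ZF _ ZF_foundation)).
  unfold sentence, ax_foundation; tr.
Qed.

Lemma pairing a b : exists p, Upair E p a b.
Proof.
  revert a b. refine (proj1 (_ : sat E s0 (sentence ax_pairing) <-> _)
    (model_ZF _ ZF_pairing)).
  unfold sentence, ax_pairing; tr.
Qed.

Lemma union_ex c : exists u, Union E u c.
Proof.
  revert c. refine (proj1 (_ : sat E s0 (sentence ax_union) <-> _)
    (model_ZF _ ZF_union)).
  unfold sentence, ax_union; tr.
Qed.

Lemma power_ex x : exists p, Power E p x.
Proof.
  revert x. refine (proj1 (_ : sat E s0 (sentence ax_power) <-> _)
    (model_ZF _ ZF_power)).
  unfold sentence, ax_power; tr.
Qed.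

Lemma infinity : exists w, Inductive_set E w.
Proof.
  refine (proj1 (_ : sat E s0 (sentence ax_infinity) <-> _)
    (model_ZF _ ZF_infinity)).
  unfold sentence, ax_infinity; tr.
Qed.

Lemma separation_sat p v a : exists b, forall x, E x b <-> E x a /\ sat E (scons x v) p.
Proof.
  destruct (bounded_ex p) as [n Hn].
  assert (Hb : bounded (1 + n) p) by (apply (bounded_mono p n); auto; lia).
  assert (H := sat_iter_all E n v s0 _ (model_ZF _ (ZF_separation n p Hb))).
  revert a. refine (proj1 (_ : sat E (prepend n v s0) (ax_separation p n) <-> _) H).
  unfold ax_separation; tr.
  apply tr_schema1 with n; auto with tr. intros j Hj.
  do 3 apply look_there. now apply look_prepend.
Qed.

Lemma replacement_sat p v a :
  (forall x, E x a -> forall y y', sat E (scons x (scons y v)) p ->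
     sat E (scons x (scons y' v)) p -> y = y') ->
  exists b, forall y, E y b <-> exists x, E x a /\ sat E (scons x (scons y v)) p.
Proof.
  destruct (bounded_ex p) as [n Hn].
  assert (Hb : bounded (2 + n) p) by (apply (bounded_mono p n); auto; lia).
  assert (H := sat_iter_all E n v s0 _ (model_ZF _ (ZF_replacement n p Hb))).
  revert a. refine (proj1 (_ : sat E (prepend n v s0) (ax_replacement p n) <-> _) H).
  unfold ax_replacement; tr; (apply tr_schema2 with n; auto 10 with tr; intros j Hj;
  repeat first [apply look_prepend; assumption | apply look_there]).
Qed.

(** [P] reads argument 0 only, so it may be evaluated at a constant sequence and every argument
    variable read as the element. Parameter variables move up by one, where the assignment supplies
    their constants. *)
Lemma separation P a : definable1 E P -> exists b, forall x, E x b <-> E x a /\ P x.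
Proof.
  intros (p & r & H).
  destruct (separation_sat (ren (fun i => match r i with inl _ => 0 | inr _ => S i end) p)
    (fun i => match r i with inl _ => a | inr c => c end) a) as [b Hb].
  exists b. intro x. rewrite Hb, sat_ren.
  change (P x) with ((fun s => P (s 0)) (fun _ : nat => x)). rewrite H.
  match goal with |- _ /\ sat _ ?e _ <-> _ /\ sat _ ?e' _ =>
    replace e' with e; [reflexivity|] end.
  apply functional_extensionality. intro i. unfold assign.
  destruct (r i) eqn:Hi; cbn; now rewrite ?Hi.
Qed.

Lemma replacement P a : definable2 E P ->
  (forall x, E x a -> forall y y', P x y -> P x y' -> y = y') ->
  exists b, forall y, E y b <-> exists x, E x a /\ P x y.
Proof.
  intros (p & r & H) Hf.
  set (g := fun i => match r i with inl 0 => 0 | inl _ => 1 | inr _ => S (S i) end).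
  set (v := fun i => match r i with inl _ => a | inr c => c end).
  assert (Hs : forall x y, sat E (scons x (scons y v)) (ren g p) <-> P x y).
  { intros x y. rewrite sat_ren.
    (* Only arguments 0 and 1 matter, so all later ones may also be read as [y]; this is why [g]
       collapses them to 1. *)
    change (P x y) with ((fun s => P (s 0) (s 1)) (scons x (fun _ : nat => y))). rewrite H.
    match goal with |- sat _ ?e _ <-> sat _ ?e' _ => replace e' with e; [reflexivity|] end.
    apply functional_extensionality. intro i. unfold assign, g, v.
    destruct (r i) as [[|j]|c] eqn:Hi; cbn; now rewrite ?Hi. }
  destruct (replacement_sat (ren g p) v a) as [b Hb].
  { intros x Hx y y'. rewrite !Hs. eauto. }
  exists b. intro y. rewrite Hb. split;
    intros (x & Hx & Hp); exists x; split; auto; now apply Hs.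
Qed.

(** ** Comprehension terms *)

(** The second disjunct fixes a value for proper classes, so by extensionality exactly one [y]
    qualifies. This uniqueness makes the graph of [setof] definable although [setof] is obtained by
    epsilon. *)
Definition is_set (P : M -> Prop) (y : M) : Prop :=
  (forall z, E z y <-> P z) \/
  ~ (exists y, forall z, E z y <-> P z) /\ forall z, ~ E z y.

(** The empty set when [{z | P z}] is a proper class. *)
Definition setof (P : M -> Prop) : M := epsilon (inhabits (s0 0)) (is_set P).

Lemma setof_spec P : is_set P (setof P).
Proof.
  apply (epsilon_spec (inhabits (s0 0)) (is_set P)).
  destruct (classic (exists y, forall z, E z y <-> P z)) as [[y Hy]|Hn].
  - exists y. now left.
  - destruct (separation (fun _ => False) (s0 0)) as [b Hb]; [apply definable_bot|].
    exists b. right. split; auto. intros z Hz. now apply Hb in Hz.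
Qed.

Lemma in_setof P z : (exists y, forall z, E z y <-> P z) -> E z (setof P) <-> P z.
Proof. intro H. destruct (setof_spec P) as [H'|[H' _]]; [auto|tauto]. Qed.

Lemma is_set_setof P y : y = setof P <-> is_set P y.
Proof.
  split; [intros ->; apply setof_spec|].
  intros H. assert (H' := setof_spec P). apply ext. intro z.
  destruct H as [H|[Hn H]], H' as [H'|[Hn' H']].
  - now rewrite H, H'.
  - exfalso; eauto.
  - exfalso; eauto.
  - specialize (H z); specialize (H' z); tauto.
Qed.

Lemma definable_term_setof (P : M -> (nat -> M) -> Prop) :
  definable E (fun s => P (s 0) (fun i => s (S i))) ->
  definable_term E (fun s => setof (fun z => P z s)).
Proof.
  intro H. unfold definable_term.
  apply definable_ext with (fun s => is_set (fun z => P z (fun i => s (S i))) (s 0)).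
  { intro s. symmetry. apply is_set_setof. }
  (* Between [z] and the arguments of [P] stands the candidate set, and in the existence clause also
     the bound set; [H1] and [H2] skip one and two positions accordingly. *)
  assert (H1 := definable_ren _ _ (fun i => match i with 0 => 0 | S i => S (S i) end) H).
  assert (H2 := definable_ren _ _ (fun i => match i with 0 => 0 | S i => S (S (S i)) end) H).
  unfold is_set. apply definable_or.
  - apply definable_all with (P := fun z s => E z (s 0) <-> P z (fun i => s (S i))).
    apply definable_iff; [apply definable_mem_var|exact H1].
  - apply definable_and.
    + apply definable_not.
      apply definable_ex with (P := fun y s => forall z, E z y <-> P z (fun i => s (S i))).
      apply definable_all with (P := fun z s => E z (s 0) <-> P z (fun i => s (S (S i)))).
      apply definable_iff; [apply definable_mem_var|exact H2].
    + apply definable_all with (P := fun z s => ~ E z (s 0)), definable_not, definable_mem_var.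
Qed.

Definition cond (P : Prop) (a b : M) : M := if excluded_middle_informative P then a else b.

Lemma cond_true (P : Prop) a b : P -> cond P a b = a.
Proof. intro H. unfold cond. destruct excluded_middle_informative; tauto. Qed.

Lemma cond_false (P : Prop) a b : ~ P -> cond P a b = b.
Proof. intro H. unfold cond. destruct excluded_middle_informative; tauto. Qed.

Lemma definable_term_cond P t u :
  definable E P -> definable_term E t -> definable_term E u ->
  definable_term E (fun s => cond (P s) (t s) (u s)).
Proof.
  intros HP Ht Hu. assert (HP' := definable_ren _ _ S HP).
  apply definable_ext with (fun s => P (fun i => s (S i)) /\ s 0 = t (fun i => s (S i)) \/
    ~ P (fun i => s (S i)) /\ s 0 = u (fun i => s (S i))).
  { intro s. unfold cond. destruct excluded_middle_informative; tauto. }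
  apply definable_or; apply definable_and; auto. apply definable_not; auto.
Qed.

Definition sep a (P : M -> Prop) := setof (fun z => E z a /\ P z).
Definition image (F : M -> M) a := setof (fun y => exists x, E x a /\ y = F x).

Create HintDb dfn.
Hint Resolve definable2_mem definable2_eq : dfn.

(** Recursion on the syntax of the body. An application of a named predicate or function is split
    into a hint for the name and subgoals for its arguments; a name without a hint is unfolded by
    hand before the call. *)
Ltac dfn :=
  cbv beta; unfold sep, image;
  lazymatch goal with
  | |- definable1 _ _ => first [solve [auto with dfn] | unfold definable1; dfn]
  | |- definable2 _ _ => first [solve [auto with dfn] | unfold definable2; dfn]
  | |- definable3 _ _ => first [solve [auto with dfn] | unfold definable3; dfn]
  | |- definable_fun1 _ _ => first [solve [auto with dfn] | unfold definable_fun1; dfn]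
  | |- definable_fun2 _ _ => first [solve [auto with dfn] | unfold definable_fun2; dfn]
  | |- definable _ (fun _ => False) => apply definable_bot
  | |- definable _ (fun s => @?A s /\ @?B s) => apply definable_and; dfn
  | |- definable _ (fun s => @?A s \/ @?B s) => apply definable_or; dfn
  | |- definable _ (fun s => @?A s <-> @?B s) => apply definable_iff; dfn
  | |- definable _ (fun s => ~ @?A s) => apply definable_not; dfn
  | |- definable _ (fun s => @?A s -> @?B s) => apply definable_imp; dfn
  | |- definable _ (fun s => forall x, _) => apply definable_all; dfn
  | |- definable _ (fun s => ex _) => apply definable_ex; dfn
  | |- definable_term _ (fun s => s _) => apply definable_term_var
  | |- definable_term _ (fun s => setof _) => apply definable_term_setof; dfn
  | |- definable_term _ (fun s => cond _ _ _) => apply definable_term_cond; dfn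
  | |- _ =>
    first
    [ apply definable_term_const
    | match goal with
      | |- definable _ (fun s => ?P (@?a s) (@?b s) (@?c s)) =>
        apply (definable3_app _ P a b c); [solve [auto with dfn]|dfn|dfn|dfn]
      | |- definable _ (fun s => ?P (@?a s) (@?b s)) =>
        apply (definable2_app _ P a b); [solve [auto with dfn]|dfn|dfn]
      | |- definable _ (fun s => ?P (@?a s)) =>
        apply (definable1_app _ P a); [solve [auto with dfn]|dfn]
      | |- definable_term _ (fun s => ?f (@?a s) (@?b s)) =>
        apply (definable_fun2_app _ f a b); [solve [auto with dfn]|dfn|dfn]
      | |- definable_term _ (fun s => ?f (@?a s)) =>
        apply (definable_fun1_app _ f a); [solve [auto with dfn]|dfn]
      end ]
  end.

Lemma definable1_empty : definable1 E (Empty E).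
Proof. unfold Empty; dfn. Qed.
Lemma definable2_sub : definable2 E (Sub E).
Proof. unfold Sub; dfn. Qed.
Lemma definable3_upair : definable3 E (Upair E).
Proof. unfold Upair; dfn. Qed.
Lemma definable2_succ : definable2 E (Succ E).
Proof. unfold Succ; dfn. Qed.
Hint Resolve definable1_empty definable2_sub definable3_upair definable2_succ : dfn.
Lemma definable1_inductive : definable1 E (Inductive_set E).
Proof. unfold Inductive_set; dfn. Qed.
Lemma definable3_pair : definable3 E (Pair E).
Proof. unfold Pair; dfn. Qed.
Hint Resolve definable1_inductive definable3_pair : dfn.
Lemma definable3_maps_to : definable3 E (Maps_to E).
Proof. unfold Maps_to; dfn. Qed.
Hint Resolve definable3_maps_to : dfn.
Lemma definable3_function : definable3 E (Function E).
Proof. unfold Function; dfn. Qed.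
Hint Resolve definable3_function : dfn.
Lemma definable3_bijection : definable3 E (Bijection E).
Proof. unfold Bijection; dfn. Qed.
Hint Resolve definable3_bijection : dfn.
Lemma definable2_equipotent : definable2 E (Equipotent E).
Proof. unfold Equipotent; dfn. Qed.
Lemma definable1_omega : definable1 E (Omega E).
Proof. unfold Omega; dfn. Qed.
Hint Resolve definable2_equipotent definable1_omega : dfn.
Lemma definable1_finite : definable1 E (Finite E).
Proof. unfold Finite; dfn. Qed.
Hint Resolve definable1_finite : dfn.

(** ** Operations *)

Definition emp := setof (fun _ => False).
Definition upair a b := setof (fun z => z = a \/ z = b).
Definition cup a b := setof (fun z => E z a \/ E z b).
Definition adj a x := setof (fun z => E z a \/ z = x).
Definition rem a x := setof (fun z => E z a /\ z <> x).
Definition bigcup c := setof (fun z => exists y, E y c /\ E z y).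
Definition pow x := setof (fun z => Sub E z x).
Definition pair a b := upair (upair a a) (upair a b).
(** For Kuratowski pairs [bigcup (bigcup f)] contains both coordinates of every pair in [f]. If [f]
    has a unique value at [a], the separated set is its singleton, and the outer union extracts
    it. *)
Definition value f a := bigcup (sep (bigcup (bigcup f)) (fun b => E (pair a b) f)).

Lemma definable_fun2_upair : definable_fun2 E upair.
Proof. unfold upair; dfn. Qed.
Lemma definable_fun2_cup : definable_fun2 E cup.
Proof. unfold cup; dfn. Qed.
Lemma definable_fun2_adj : definable_fun2 E adj.
Proof. unfold adj; dfn. Qed.
Lemma definable_fun2_rem : definable_fun2 E rem.
Proof. unfold rem; dfn. Qed.
Lemma definable_fun1_bigcup : definable_fun1 E bigcup.
Proof. unfold bigcup; dfn. Qed.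
Lemma definable_fun1_pow : definable_fun1 E pow.
Proof. unfold pow; dfn. Qed.
Hint Resolve definable_fun2_upair definable_fun2_cup definable_fun2_adj
  definable_fun2_rem definable_fun1_bigcup definable_fun1_pow : dfn.
Lemma definable_fun2_pair : definable_fun2 E pair.
Proof. unfold pair; dfn. Qed.
Hint Resolve definable_fun2_pair : dfn.
Lemma definable_fun2_value : definable_fun2 E value.
Proof. unfold value; dfn. Qed.
Hint Resolve definable_fun2_value : dfn.

Lemma in_sep a P z : definable1 E P -> E z (sep a P) <-> E z a /\ P z.
Proof. intro H. apply in_setof, separation, H. Qed.

Lemma in_image F a y : definable_fun1 E F -> E y (image F a) <-> exists x, E x a /\ y = F x.
Proof.
  intro H. apply in_setof.
  apply (replacement (fun x y => y = F x)); [dfn|congruence].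
Qed.

Lemma in_emp z : ~ E z emp.
Proof.
  unfold emp. rewrite in_setof; auto.
  destruct (separation (fun _ => False) (s0 0)) as [b Hb]; [dfn|].
  exists b. intro x. rewrite Hb. tauto.
Qed.

Lemma in_upair a b z : E z (upair a b) <-> z = a \/ z = b.
Proof. apply in_setof, pairing. Qed.

Lemma in_bigcup c z : E z (bigcup c) <-> exists y, E y c /\ E z y.
Proof. apply in_setof, union_ex. Qed.

Lemma in_pow x z : E z (pow x) <-> Sub E z x.
Proof. exact (in_setof _ z (power_ex x)). Qed.

Lemma in_cup a b z : E z (cup a b) <-> E z a \/ E z b.
Proof.
  apply in_setof. exists (bigcup (upair a b)). intro x. rewrite in_bigcup.
  split.
  - intros (y & Hy & Hx). apply in_upair in Hy as [->| ->]; auto.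
  - intros [H|H]; eexists; (split; [apply in_upair|exact H]); auto.
Qed.

Lemma in_adj a x z : E z (adj a x) <-> E z a \/ z = x.
Proof.
  apply in_setof. exists (cup a (upair x x)). intro y. rewrite in_cup, in_upair. tauto.
Qed.

Lemma in_rem a x z : E z (rem a x) <-> E z a /\ z <> x.
Proof. apply in_sep; dfn. Qed.

Lemma adj_rem a x : E x a -> adj (rem a x) x = a.
Proof.
  intro H. apply ext. intro z. rewrite in_adj, in_rem.
  destruct (classic (z = x)) as [->|]; tauto.
Qed.

Lemma adj_in a x : E x a -> adj a x = a.
Proof.
  intro H. apply ext. intro z. rewrite in_adj. split; [intros [| ->]|]; auto.
Qed.

Lemma upair_inj a b c d : upair a b = upair c d -> a = c /\ b = d \/ a = d /\ b = c.
Proof.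
  intro H.
  assert (Ha : E a (upair c d)) by (rewrite <- H; apply in_upair; auto).
  assert (Hb : E b (upair c d)) by (rewrite <- H; apply in_upair; auto).
  assert (Hc : E c (upair a b)) by (rewrite H; apply in_upair; auto).
  assert (Hd : E d (upair a b)) by (rewrite H; apply in_upair; auto).
  rewrite in_upair in *. intuition congruence.
Qed.

Lemma pair_inj a b c d : pair a b = pair c d -> a = c /\ b = d.
Proof.
  intro H. apply upair_inj in H as [[H1 H2]|[H1 H2]];
    apply upair_inj in H1, H2; intuition congruence.
Qed.

Lemma upair_iff p a b : Upair E p a b <-> p = upair a b.
Proof.
  split; [|intros -> z; apply in_upair].
  intro H. apply ext. intro z. rewrite in_upair. apply H.
Qed.

Lemma pair_iff p a b : Pair E p a b <-> p = pair a b.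
Proof.
  split.
  - intros (s & t & H1 & H2 & H3). apply upair_iff in H1, H2, H3. now subst.
  - intros ->. exists (upair a a), (upair a b). now rewrite !upair_iff.
Qed.

Lemma maps_to_iff f a b : Maps_to E f a b <-> E (pair a b) f.
Proof.
  split.
  - intros (p & H1 & H2). apply pair_iff in H1. now subst.
  - intro H. exists (pair a b). now rewrite pair_iff.
Qed.

Lemma value_spec f x y a b : Function E f x y -> E a x ->
  Maps_to E f a b <-> b = value f a.
Proof.
  intros [_ H] Ha. destruct (H a Ha) as (c & Hc & Hu).
  assert (Hf : value f a = c).
  { apply ext. intro z. unfold value. rewrite in_bigcup. split.
    - intros (y' & Hy & Hz). apply in_sep in Hy as [_ Hy]; [|dfn].
      apply maps_to_iff, Hu in Hy. now subst.
    - intro Hz. exists c. split; auto. apply in_sep; [dfn|].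
      apply maps_to_iff in Hc. split; auto. apply in_bigcup.
      exists (upair a c). split; [|apply in_upair; auto].
      apply in_bigcup. exists (pair a c). split; auto. apply in_upair; auto. }
  rewrite Hf. split; [auto|now intros ->].
Qed.

Lemma value_in f x y a : Function E f x y -> E a x -> E (value f a) y.
Proof.
  intros Hf Ha. assert (H := proj2 (value_spec f x y a _ Hf Ha) eq_refl).
  destruct H as (p & Hp & Hpf). apply pair_iff in Hp.
  destruct (proj1 Hf p Hpf) as (a' & b' & _ & Hb & Hp'). apply pair_iff in Hp'.
  subst p. apply pair_inj in Hp' as [_ ->]. auto.
Qed.

Definition graph (F : M -> M) x := image (fun a => pair a (F a)) x.

Lemma graph_maps_to F x a b : definable_fun1 E F ->
  Maps_to E (graph F x) a b <-> E a x /\ b = F a.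
Proof.
  intro HF. rewrite maps_to_iff. unfold graph. rewrite in_image by dfn. split.
  - intros (c & Hc & H). apply pair_inj in H as [-> ->]. auto.
  - intros [H ->]. eauto.
Qed.

Lemma graph_function F x y : definable_fun1 E F -> (forall a, E a x -> E (F a) y) ->
  Function E (graph F x) x y.
Proof.
  intros HF H. split.
  - intros p Hp. unfold graph in Hp. apply in_image in Hp as (a & Ha & ->); [|dfn].
    exists a, (F a). rewrite pair_iff. auto.
  - intros a Ha. exists (F a). rewrite graph_maps_to by auto. split; auto.
    intros b'. rewrite graph_maps_to by auto. tauto.
Qed.

(** ** Equipotence *)

(** Bijections as functions of the metatheory: composites and modified maps are written directly,
    and [graph] turns them into sets once they are known to be definable. *)
Definition bij (F : M -> M) x y :=
  (forall a, E a x -> E (F a) y) /\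
  (forall a b, E a x -> E b x -> F a = F b -> a = b) /\
  (forall b, E b y -> exists a, E a x /\ b = F a).

Lemma bij_equipotent F x y : definable_fun1 E F -> bij F x y -> Equipotent E x y.
Proof.
  intros HF (H1 & H2 & H3). exists (graph F x). split; [now apply graph_function|].
  split.
  - intros a a' b. rewrite !graph_maps_to by auto. intros [Ha ->] [Ha' H]. auto.
  - intros b Hb. destruct (H3 b Hb) as (a & Ha & ->). exists a.
    now rewrite graph_maps_to.
Qed.

Lemma bijection_bij f x y : Bijection E f x y -> bij (value f) x y.
Proof.
  intros (H1 & H2 & H3). repeat split.
  - intros a. now apply value_in.
  - intros a b Ha Hb H. apply (H2 a b (value f a)); [|rewrite H]; now apply (value_spec f x y).
  - intros b Hb. destruct (H3 b Hb) as [a Hab]. exists a.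
    assert (Ha : E a x).
    { destruct Hab as (p & Hp & Hpf). destruct (proj1 H1 p Hpf) as (a' & b' & Ha & _ & Hp').
      apply pair_iff in Hp, Hp'. subst p. apply pair_inj in Hp' as [-> _]. auto. }
    split; auto. now apply (value_spec f x y).
Qed.

Lemma equipotent_bij x y : Equipotent E x y -> exists F, definable_fun1 E F /\ bij F x y.
Proof. intros [f Hf]. exists (value f). split; [dfn|now apply bijection_bij]. Qed.

Lemma equipotent_refl x : Equipotent E x x.
Proof.
  apply bij_equipotent with (fun a => a); [dfn|]. repeat split; eauto.
Qed.

Lemma equipotent_sym x y : Equipotent E x y -> Equipotent E y x.
Proof.
  intro H. apply equipotent_bij in H as (F & HF & H1 & H2 & H3).
  (* The inverse: the preimage of [b] in [x] is a singleton, and its union is the element sought. *)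
  set (G := fun b => bigcup (sep x (fun a => b = F a))).
  assert (HG : forall a, E a x -> G (F a) = a).
  { intros a Ha. apply ext. intro z. unfold G. rewrite in_bigcup. split.
    - intros (c & Hc & Hz). apply in_sep in Hc as [Hc He]; [|dfn].
      apply H2 in He; auto. now subst.
    - intro Hz. exists a. split; auto. apply in_sep; [dfn|auto]. }
  apply bij_equipotent with G; [unfold G; dfn|]. repeat split.
  - intros b Hb. destruct (H3 b Hb) as (a & Ha & ->). now rewrite HG.
  - intros b b' Hb Hb'. destruct (H3 b Hb) as (a & Ha & ->).
    destruct (H3 b' Hb') as (a' & Ha' & ->). rewrite !HG by auto. congruence.
  - intros a Ha. exists (F a). rewrite HG; auto.
Qed.

Lemma equipotent_trans x y z : Equipotent E x y -> Equipotent E y z -> Equipotent E x z.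
Proof.
  intros H H'. apply equipotent_bij in H as (F & HF & H1 & H2 & H3).
  apply equipotent_bij in H' as (G & HG & H4 & H5 & H6).
  apply bij_equipotent with (fun a => G (F a)); [dfn|]. repeat split.
  - auto.
  - intros a b Ha Hb H. auto.
  - intros c Hc. destruct (H6 c Hc) as (b & Hb & ->).
    destruct (H3 b Hb) as (a & Ha & ->). eauto.
Qed.

Lemma equipotent_adj x y a b : ~ E a x -> ~ E b y ->
  Equipotent E x y -> Equipotent E (adj x a) (adj y b).
Proof.
  intros Ha Hb H. apply equipotent_bij in H as (F & HF & H1 & H2 & H3).
  set (G := fun c => cond (c = a) b (F c)).
  assert (Ga : G a = b) by now apply cond_true.
  assert (Gx : forall c, E c x -> G c = F c).
  { intros c Hc. apply cond_false. congruence. }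
  apply bij_equipotent with G; [unfold G; dfn|]. repeat split.
  - intros c. rewrite !in_adj. intros [Hc| ->]; rewrite ?Gx by auto; auto.
  - intros c d. rewrite !in_adj. intros [Hc| ->] [Hd| ->]; rewrite ?Ga, ?Gx by auto;
      intro He; auto; exfalso; [apply Hb; rewrite <- He|apply Hb; rewrite He]; auto.
  - intros d. rewrite in_adj. intros [Hd| ->].
    + destruct (H3 d Hd) as (c & Hc & ->). exists c. rewrite in_adj, Gx; auto.
    + exists a. rewrite in_adj; auto.
Qed.

(** The element of [x] sent to [b], if there is one, is redirected to [F a], the value freed by
    dropping [a]. If [F a = b], no element needs redirecting. *)
Lemma equipotent_adj_inv x y a b : ~ E a x -> ~ E b y ->
  Equipotent E (adj x a) (adj y b) -> Equipotent E x y.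
Proof.
  intros Ha Hb H. apply equipotent_bij in H as (F & HF & H1 & H2 & H3).
  set (G := fun c => cond (F c = b) (F a) (F c)).
  assert (Hax : E a (adj x a)) by (apply in_adj; auto).
  assert (Hxx : forall c, E c x -> E c (adj x a)) by (intros; apply in_adj; auto).
  assert (Hne : forall c, E c x -> F c <> F a).
  { intros c Hc He. apply H2 in He; auto. congruence. }
  assert (Hin : forall c, E c (adj x a) -> F c <> b -> E (F c) y).
  { intros c Hc Hn. apply H1, in_adj in Hc. tauto. }
  apply bij_equipotent with G; [unfold G; dfn|]. repeat split.
  - intros c Hc. unfold G. destruct (classic (F c = b)) as [He|He].
    + rewrite cond_true by auto. apply Hin; auto. rewrite <- He. intro. now apply (Hne c).
    + rewrite cond_false by auto. auto.
  - intros c d Hc Hd. unfold G.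
    destruct (classic (F c = b)); [rewrite cond_true by auto|rewrite cond_false by auto];
    destruct (classic (F d = b)); [rewrite cond_true by auto|rewrite cond_false by auto| |].
    + intros _. apply H2; auto. congruence.
    + intro He. now apply eq_sym, Hne in He.
    + rewrite cond_true by auto. intro He. now apply Hne in He.
    + rewrite cond_false by auto. apply H2; auto.
  - intros d Hd. destruct (H3 d) as (c & Hc & ->); [apply in_adj; auto|].
    apply in_adj in Hc as [Hc| ->].
    + exists c. split; auto. unfold G. rewrite cond_false; auto. congruence.
    + destruct (H3 b) as (c & Hc & He); [apply in_adj; auto|].
      apply in_adj in Hc as [Hc| ->]; [|congruence].
      exists c. split; auto. unfold G. now rewrite cond_true.
Qed.

(** ** Natural numbers and finite sets *)

Definition omega := setof (fun n => forall v, Inductive_set E v -> E n v).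

Lemma in_omega n : E n omega <-> forall v, Inductive_set E v -> E n v.
Proof.
  apply in_setof. destruct infinity as [w Hw].
  destruct (separation (fun n => forall v, Inductive_set E v -> E n v) w) as [b Hb]; [dfn|].
  exists b. intro x. rewrite Hb. split; [tauto|auto].
Qed.

Lemma succ_iff s n : Succ E s n <-> s = adj n n.
Proof.
  split; [|intros -> z; apply in_adj].
  intro H. apply ext. intro z. rewrite in_adj. apply H.
Qed.

Lemma empty_iff e : Empty E e <-> e = emp.
Proof.
  split; [|intros -> z; apply in_emp].
  intro H. apply ext. intro z. specialize (H z). assert (H' := in_emp z). tauto.
Qed.

Lemma inductive_iff w :
  Inductive_set E w <-> E emp w /\ forall n, E n w -> E (adj n n) w.
Proof.
  split.
  - intros [(e & He & Hw) H]. apply empty_iff in He. subst e. split; auto.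
    intros n Hn. destruct (H n Hn) as (s & Hs & Hsw). apply succ_iff in Hs. now subst.
  - intros [H1 H2]. split.
    + exists emp. now rewrite empty_iff.
    + intros n Hn. exists (adj n n). rewrite succ_iff. auto.
Qed.

Lemma omega_inductive : Inductive_set E omega.
Proof.
  apply inductive_iff. split.
  - apply in_omega. intros v Hv. now apply inductive_iff in Hv as [? _].
  - intros n Hn. apply in_omega. intros v Hv. assert (Hv' := Hv).
    apply inductive_iff in Hv as [_ Hv]. apply Hv. now apply in_omega.
Qed.

Lemma omega_iff w : Omega E w <-> w = omega.
Proof.
  assert (Ho : forall v, Inductive_set E v -> Sub E omega v).
  { intros v Hv n Hn. now apply in_omega. }
  split.
  - intros [H1 H2]. apply ext. intro z. split; [apply H2, omega_inductive|now apply Ho].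
  - intros ->. split; [apply omega_inductive|exact Ho].
Qed.

Lemma emp_omega : E emp omega.
Proof. apply inductive_iff, omega_inductive. Qed.

Lemma succ_omega n : E n omega -> E (adj n n) omega.
Proof. apply inductive_iff, omega_inductive. Qed.

(** Definability is what turns [P] into a subset of [omega] in the structure, to which minimality
    among inductive sets applies. *)
Lemma omega_ind P : definable1 E P -> P emp -> (forall n, E n omega -> P n -> P (adj n n)) ->
  forall n, E n omega -> P n.
Proof.
  intros HP H0 HS n Hn.
  assert (Hi : Inductive_set E (sep omega P)).
  { apply inductive_iff. split; [apply in_sep; auto using emp_omega|].
    intros m Hm. apply in_sep in Hm as [H1 H2]; auto. apply in_sep; auto using succ_omega. }
  apply (proj1 (in_omega n) Hn) in Hi. now apply in_sep in Hi.
Qed.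

Ltac omega_induction :=
  match goal with |- forall n, E n omega -> @?P n => apply (omega_ind P); cbv beta end.

Lemma mem_irrefl x : ~ E x x.
Proof.
  intro H. destruct (foundation (upair x x)) as (y & Hy & Hn).
  - exists x. apply in_upair. auto.
  - apply in_upair in Hy. assert (y = x) by tauto. subst y. apply Hn.
    exists x. rewrite in_upair. auto.
Qed.

Lemma omega_elem n : E n omega -> forall m, E m n -> E m omega /\ Sub E m n.
Proof.
  revert n. omega_induction.
  - dfn.
  - intros m Hm. now apply in_emp in Hm.
  - intros n Hn IH m Hm. apply in_adj in Hm as [Hm| ->].
    + destruct (IH m Hm) as [H1 H2]. split; auto. intros z Hz. apply in_adj. auto.
    + split; auto. intros z Hz. apply in_adj. auto.
Qed.

Lemma emp_or_mem n : E n omega -> n = emp \/ E emp n.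
Proof.
  revert n. omega_induction; [dfn|auto|]. intros n _ [-> |H]; right; apply in_adj; auto.
Qed.

Lemma succ_lt n : E n omega -> forall m, E m n -> adj m m = n \/ E (adj m m) n.
Proof.
  revert n. omega_induction; [dfn| |].
  - intros m Hm. now apply in_emp in Hm.
  - intros n _ IH m Hm. apply in_adj in Hm as [Hm| ->]; auto.
    right. apply in_adj. destruct (IH m Hm); auto.
Qed.

Lemma trichotomy n : E n omega -> forall m, E m omega -> E m n \/ m = n \/ E n m.
Proof.
  revert n. omega_induction; [dfn| |].
  - intros m Hm. destruct (emp_or_mem m Hm); auto.
  - intros n Hn IH m Hm. rewrite in_adj. destruct (IH m Hm) as [H|[H|H]]; auto.
    destruct (succ_lt m Hm n H); auto.
Qed.

Lemma finite_iff x : Finite E x <-> exists n, E n omega /\ Equipotent E x n.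
Proof.
  split.
  - intros (w & n & Hw & Hn & H). apply omega_iff in Hw. subst. eauto.
  - intros (n & Hn & H). exists omega, n. now rewrite omega_iff.
Qed.

Lemma equipotent_finite x y : Equipotent E x y -> Finite E y -> Finite E x.
Proof.
  rewrite !finite_iff. intros H (n & Hn & H'). exists n. split; auto.
  eapply equipotent_trans; eauto.
Qed.

Lemma finite_emp : Finite E emp.
Proof. apply finite_iff. exists emp. auto using emp_omega, equipotent_refl. Qed.

Lemma finite_adj x a : Finite E x -> Finite E (adj x a).
Proof.
  intro H. destruct (classic (E a x)) as [Ha|Ha]; [now rewrite adj_in|].
  apply finite_iff in H as (n & Hn & H). apply finite_iff. exists (adj n n).
  auto using succ_omega, equipotent_adj, mem_irrefl.
Qed.

(** Induction on the number of elements: for a set equipotent with [adj n n], deleting the preimage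
    of [n] leaves a set equipotent with [n]. *)
Lemma finite_ind P : definable1 E P -> P emp ->
  (forall x a, Finite E x -> ~ E a x -> P x -> P (adj x a)) ->
  forall x, Finite E x -> P x.
Proof.
  intros HP H0 HS x Hx. apply finite_iff in Hx as (n & Hn & Hx). revert n Hn x Hx.
  omega_induction; [dfn| |].
  - intros x Hx. replace x with emp; auto. apply ext. intro z.
    apply equipotent_bij in Hx as (F & _ & H & _).
    split; intro Hz; exfalso; [|apply H in Hz]; now apply in_emp in Hz.
  - intros n Hn IH x Hx. assert (Hx' := Hx).
    apply equipotent_bij in Hx' as (F & _ & _ & _ & H).
    destruct (H n) as (a & Ha & _); [apply in_adj; auto|].
    assert (Hr : Equipotent E (rem x a) n).
    { apply equipotent_adj_inv with a n.
      - rewrite in_rem. tauto.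
      - apply mem_irrefl.
      - now rewrite adj_rem. }
    rewrite <- (adj_rem x a) by auto. apply HS; auto.
    + apply finite_iff. eauto.
    + rewrite in_rem. tauto.
Qed.

Ltac finite_induction :=
  match goal with |- forall x, Finite E x -> @?P x => apply (finite_ind P); cbv beta end.

Lemma finite_sub x : Finite E x -> forall y, Sub E y x -> Finite E y.
Proof.
  revert x. finite_induction; [dfn| |].
  - intros y Hy. replace y with emp; [apply finite_emp|]. apply ext. intro z.
    split; intro Hz; [now apply in_emp in Hz|auto].
  - intros x a _ _ IH y Hy.
    assert (Hr : Finite E (rem y a)).
    { apply IH. intros z Hz. apply in_rem in Hz as [Hz Hn].
      apply Hy, in_adj in Hz as [|]; tauto. }
    destruct (classic (E a y)) as [Ha|Ha].
    + rewrite <- (adj_rem y a) by auto. now apply finite_adj.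
    + replace y with (rem y a); auto. apply ext. intro z. rewrite in_rem.
      split; [tauto|]. intro Hz. split; congruence.
Qed.

Lemma finite_image F : definable_fun1 E F -> forall x, Finite E x -> Finite E (image F x).
Proof.
  intro HF. finite_induction; [dfn| |].
  - replace (image F emp) with emp; [apply finite_emp|]. apply ext. intro z.
    rewrite in_image by auto. split; [intro H; now apply in_emp in H|].
    intros (y & Hy & _). now apply in_emp in Hy.
  - intros x a _ _ IH. replace (image F (adj x a)) with (adj (image F x) (F a)).
    + now apply finite_adj.
    + apply ext. intro z. rewrite in_adj, !in_image by auto. split.
      * intros [(y & Hy & ->)| ->]; eexists; (split; [apply in_adj|reflexivity]); auto.
      * intros (y & Hy & ->). apply in_adj in Hy as [Hy| ->]; eauto.
Qed.

Lemma finite_cup x y : Finite E x -> Finite E y -> Finite E (cup x y).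
Proof.
  intro Hx. revert y. finite_induction; [dfn| |].
  - apply (finite_sub x); auto. intros z Hz. apply in_cup in Hz as [|Hz]; auto.
    now apply in_emp in Hz.
  - intros y a _ _ IH. apply (finite_sub (adj (cup x y) a)); [now apply finite_adj|].
    intros z. rewrite in_adj, !in_cup, in_adj. tauto.
Qed.

Lemma finite_bigcup x : Finite E x -> (forall y, E y x -> Finite E y) -> Finite E (bigcup x).
Proof.
  revert x. finite_induction; [dfn| |].
  - intros _. apply (finite_sub emp); [apply finite_emp|]. intros z Hz.
    apply in_bigcup in Hz as (y & Hy & _). now apply in_emp in Hy.
  - intros x a _ _ IH H. apply (finite_sub (cup (bigcup x) a)).
    + apply finite_cup; [apply IH; intros|]; apply H, in_adj; auto.
    + intros z Hz. apply in_bigcup in Hz as (y & Hy & Hz). apply in_cup.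
      rewrite in_bigcup. apply in_adj in Hy as [Hy| ->]; eauto.
Qed.

Lemma finite_pow x : Finite E x -> Finite E (pow x).
Proof.
  revert x. finite_induction; [dfn| |].
  - apply (finite_sub (adj emp emp)); [apply finite_adj, finite_emp|].
    intros z Hz. apply in_adj. right. apply ext. intro y. apply in_pow in Hz.
    split; [auto|]. intro Hy. now apply in_emp in Hy.
  - intros x a _ _ IH.
    (* A subset of [adj x a] either is a subset of [x] or arises from one by adjoining [a]. *)
    apply (finite_sub (cup (pow x) (image (fun y => adj y a) (pow x)))).
    { apply finite_cup; auto. apply finite_image; auto. dfn. }
    intros y Hy. apply in_pow in Hy. apply in_cup. rewrite in_image by dfn.
    assert (Hr : Sub E (rem y a) x).
    { intros z Hz. apply in_rem in Hz as [Hz Hn]. apply Hy, in_adj in Hz. tauto. }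
    destruct (classic (E a y)) as [Ha|Ha].
    + right. exists (rem y a). rewrite adj_rem, in_pow by auto. auto.
    + left. apply in_pow. intros z Hz. apply Hr, in_rem. split; congruence.
Qed.

(* A bijection with a proper subset is transported from [adj y a] to [y] by
   deleting [a], or, if the subset misses [a], any of its elements. *)
Lemma finite_dedekind y : Finite E y -> forall x, Sub E x y -> Equipotent E x y -> x = y.
Proof.
  revert y. finite_induction; [dfn| |].
  - intros x H _. apply ext. intro z. split; [apply H|]. intro Hz. now apply in_emp in Hz.
  - intros y a _ Ha IH x Hs He.
    assert (Hdel : forall c, E c x -> Equipotent E (rem x c) y).
    { intros c Hc. apply equipotent_adj_inv with c a; auto.
      - rewrite in_rem. tauto.
      - now rewrite adj_rem. }
    destruct (classic (E a x)) as [Hax|Hax].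
    + rewrite <- (adj_rem x a) by auto. f_equal. apply IH; auto.
      intros z Hz. apply in_rem in Hz as [Hz Hn]. apply Hs, in_adj in Hz. tauto.
    + exfalso. assert (He' := He).
      apply equipotent_bij in He' as (F & _ & _ & _ & H).
      destruct (H a) as (c & Hc & _); [apply in_adj; auto|].
      assert (Hsub : Sub E x y).
      { intros z Hz. assert (Hz' := Hs z Hz). apply in_adj in Hz' as [|]; [auto|congruence]. }
      assert (Hr : rem x c = y).
      { apply IH; auto. intros z Hz. apply in_rem in Hz as [Hz _]. auto. }
      apply Hsub in Hc. rewrite <- Hr in Hc. apply in_rem in Hc. tauto.
Qed.

Lemma finite_elem n : E n omega -> Finite E n.
Proof. intro H. apply finite_iff. exists n. auto using equipotent_refl. Qed.

(** Of two natural numbers one is a subset of the other, and a finite set is not equipotent with a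
    proper subset. *)
Lemma omega_equipotent_eq m n : E m omega -> E n omega -> Equipotent E m n -> m = n.
Proof.
  intros Hm Hn H. destruct (trichotomy n Hn m Hm) as [Hl|[Hl|Hl]]; auto.
  - apply finite_dedekind; auto using finite_elem. now apply omega_elem.
  - symmetry. apply finite_dedekind; auto using finite_elem, equipotent_sym.
    now apply omega_elem.
Qed.

(** The successor map is a bijection from [omega] onto its nonzero elements, a proper subset, which
    [finite_dedekind] excludes for a finite set. *)
Lemma omega_infinite : ~ Finite E omega.
Proof.
  intro H. assert (Hr : rem omega emp = omega).
  { apply finite_dedekind; auto.
    - intros z Hz. now apply in_rem in Hz.
    - apply equipotent_sym. apply bij_equipotent with (fun n => adj n n); [dfn|].
      repeat split.
      + intros n Hn. apply in_rem. split; [now apply succ_omega|].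
        intro He. apply (in_emp n). rewrite <- He. apply in_adj. auto.
      + intros m n Hm Hn He. apply omega_equipotent_eq; auto.
        apply equipotent_adj_inv with m n; auto using mem_irrefl.
        rewrite He. apply equipotent_refl.
      + intros n Hn. apply in_rem in Hn as [Hn Hne]. revert n Hn Hne.
        omega_induction; [dfn| |].
        * congruence.
        * eauto. }
  assert (He := emp_omega). rewrite <- Hr in He. apply in_rem in He. tauto.
Qed.

Lemma denumerable_iff x : Denumerable E x <-> Equipotent E x omega.
Proof.
  split.
  - intros (w & Hw & H). apply omega_iff in Hw. now subst.
  - intro H. exists omega. now rewrite omega_iff.
Qed.

Definition inter a b := sep a (fun z => E z b).

Lemma in_inter a b z : E z (inter a b) <-> E z a /\ E z b.
Proof. apply (in_sep a (fun z => E z b)). dfn. Qed.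

Lemma definable_fun2_inter : definable_fun2 E inter.
Proof. unfold inter; dfn. Qed.
Hint Resolve definable_fun2_inter : dfn.

(* An element [a] is sent to the number of its predecessors in [A]. *)
Lemma infinite_sub_omega A : Sub E A omega -> ~ Finite E A -> Equipotent E A omega.
Proof.
  intros HA Hinf.
  set (k := fun a => bigcup (sep omega (fun n => Equipotent E (inter A a) n))).
  assert (Hk : forall a n, E n omega -> Equipotent E (inter A a) n -> k a = n).
  { intros a n Hn He. apply ext. intro z. unfold k. rewrite in_bigcup. split.
    - intros (m & Hm & Hz). apply in_sep in Hm as [Hm He']; [|dfn].
      replace n with m; auto. apply omega_equipotent_eq; auto.
      eapply equipotent_trans; [apply equipotent_sym|]; eauto.
    - intro Hz. exists n. split; auto. apply in_sep; [dfn|auto]. }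
  assert (Hex : forall a, E a A -> exists n, E n omega /\ Equipotent E (inter A a) n).
  { intros a Ha. apply finite_iff, (finite_sub a); [apply finite_elem, HA, Ha|].
    intros z Hz. now apply in_inter in Hz. }
  (* The predecessors of [a] in [A] form a proper subset of those of [b], since [a] lies in the
     latter only. Equal counts would make these finite sets equipotent. *)
  assert (Hlt : forall a b, E a A -> E b A -> E a b -> k a <> k b).
  { intros a b Ha Hb Hab He.
    destruct (Hex a Ha) as (m & Hm & Hem), (Hex b Hb) as (n & Hn & Hen).
    rewrite (Hk a m), (Hk b n) in He by auto. subst n.
    assert (Hc : inter A a = inter A b).
    { apply finite_dedekind.
      - apply finite_iff; eauto.
      - intro z. rewrite !in_inter. intros [H1 H2]. split; auto.
        apply (omega_elem b (HA b Hb) a); auto.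
      - eapply equipotent_trans; [exact Hem|]. now apply equipotent_sym. }
    apply (mem_irrefl a). apply (in_inter A a). rewrite Hc. now apply in_inter. }
  assert (Hleast : forall B, Sub E B A -> (exists b, E b B) ->
    exists b, E b B /\ forall c, E c A -> E c b -> ~ E c B).
  { intros B HB Hne. destruct (foundation B Hne) as (b & Hb & Hm).
    exists b. split; auto. intros c _ Hcb HcB. apply Hm. eauto. }
  apply bij_equipotent with k; [unfold k; dfn|]. repeat split.
  - intros a Ha. destruct (Hex a Ha) as (n & Hn & He). now rewrite (Hk a n).
  - intros a b Ha Hb He.
    destruct (trichotomy b (HA b Hb) a (HA a Ha)) as [H|[H|H]]; auto.
    + exfalso. now apply (Hlt a b).
    + exfalso. now apply (Hlt b a).
  - enough (Hs : forall n, E n omega -> exists a, E a A /\ Equipotent E (inter A a) n).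
    { intros n Hn. destruct (Hs n Hn) as (a & Ha & He). exists a. rewrite (Hk a n); auto. }
    omega_induction; [dfn| |].
    + destruct (Hleast A) as (a & Ha & Hm); [intro; auto| |].
      { apply NNPP. intro Hn. apply Hinf, (finite_sub emp); [apply finite_emp|].
        intros z Hz. exfalso. eauto. }
      exists a. split; auto. replace (inter A a) with emp; [apply equipotent_refl|].
      apply ext. intro z. rewrite in_inter. split; [intro Hz; now apply in_emp in Hz|].
      intros [H1 H2]. exfalso. now apply (Hm z).
    + intros n Hn (a & Ha & He).
      (* [adj a a] consists of the numbers up to [a], so [b] is the next element of [A]. Its
         predecessors in [A] are those of [a] and [a] itself, one more than before. *)
      destruct (Hleast (sep A (fun z => ~ E z (adj a a)))) as (b & Hb & Hm).
      { intros z Hz. apply in_sep in Hz; [tauto|dfn]. }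
      { apply NNPP. intro Hno. apply Hinf, (finite_sub (adj a a)).
        - apply finite_adj, finite_elem; auto.
        - intros z Hz. apply NNPP. intro Hza. apply Hno. exists z.
          apply in_sep; [dfn|auto]. }
      apply in_sep in Hb as [Hb Hba]; [|dfn]. exists b. split; auto.
      replace (inter A b) with (adj (inter A a) a).
      * apply equipotent_adj; auto using mem_irrefl.
        intro H. apply in_inter in H as [_ H]. now apply mem_irrefl in H.
      * assert (Hab : Sub E (adj a a) b).
        { assert (Ho : E (adj a a) omega) by (apply succ_omega; auto).
          destruct (trichotomy (adj a a) Ho b (HA b Hb)) as [H|[->|H]].
          - contradiction.
          - intros z; auto.
          - apply (omega_elem b (HA b Hb)); auto. }
        apply ext. intro z. rewrite in_adj, !in_inter. split.
        -- intros [[H1 H2]| ->]; split; auto; apply Hab, in_adj; auto.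
        -- intros [H1 H2]. specialize (Hm z H1 H2). rewrite in_sep in Hm by dfn.
           apply NNPP. intro Hno. apply Hm. split; auto. rewrite in_adj. tauto.
Qed.

(* Every value is taken at a least argument. *)
Lemma infinite_image_omega H : definable_fun1 E H -> ~ Finite E (image H omega) ->
  Equipotent E omega (image H omega).
Proof.
  intros HH Hinf.
  set (A := sep omega (fun n => forall m, E m n -> H m <> H n)).
  assert (HA : forall n, E n A <-> E n omega /\ forall m, E m n -> H m <> H n).
  { intro n. apply in_sep; dfn. }
  assert (Heq : Equipotent E A (image H omega)).
  { apply bij_equipotent with H; auto. repeat split.
    - intros n Hn. apply HA in Hn as [Hn _]. apply in_image; eauto.
    - intros m n Hm Hn He. apply HA in Hm as [Hm Hm'], Hn as [Hn Hn'].
      destruct (trichotomy n Hn m Hm) as [Hl|[Hl|Hl]]; auto.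
      + now apply Hn' in Hl.
      + now apply Hm', not_eq_sym in Hl.
    - intros b Hb. apply in_image in Hb as (n & Hn & ->); auto.
      destruct (foundation (sep omega (fun m => H m = H n))) as (m & Hm & Hmin).
      { exists n. apply in_sep; [dfn|auto]. }
      apply in_sep in Hm as [Hm He]; [|dfn]. exists m. split; [|auto]. apply HA.
      split; auto. intros l Hl Hle. apply Hmin. exists l. split; auto.
      apply in_sep; [dfn|]. split; [|congruence]. now apply (omega_elem m Hm). }
  eapply equipotent_trans; [apply equipotent_sym|exact Heq].
  apply infinite_sub_omega.
  - intros n Hn. now apply HA in Hn.
  - intro Hf. apply Hinf, (equipotent_finite _ A); auto. now apply equipotent_sym.
Qed.

(** ** Finite partitions *)

(** The points that no member of [F] separates from [x]. Equivalently, the intersection within [X]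
    of the members of [F] containing [x] and the complements of the others. *)
Definition atom X F x := sep X (fun y => forall A, E A F -> E x A <-> E y A).
Definition atoms X F := image (atom X F) X.

Lemma definable_fun1_atom X F : definable_fun1 E (atom X F).
Proof. unfold atom; dfn. Qed.
Hint Resolve definable_fun1_atom : dfn.

Lemma definable_fun2_atoms : definable_fun2 E atoms.
Proof. unfold atoms, atom; dfn. Qed.
Hint Resolve definable_fun2_atoms : dfn.

Lemma in_atom X F x y :
  E y (atom X F x) <-> E y X /\ forall A, E A F -> E x A <-> E y A.
Proof. apply (in_sep X (fun y => forall A, E A F -> E x A <-> E y A)). dfn. Qed.

Lemma in_atoms X F c : E c (atoms X F) <-> exists x, E x X /\ c = atom X F x.
Proof. apply in_image. dfn. Qed.

(* The atom of [x] only depends on the subset [{A in F | x in A}] of [F]. *)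
Lemma atoms_finite X F : Finite E F -> Finite E (atoms X F).
Proof.
  intro HF. apply (finite_sub (image
    (fun S => sep X (fun y => forall A, E A F -> E A S <-> E y A)) (pow F))).
  { apply finite_image; [dfn|]. now apply finite_pow. }
  intros c Hc. apply in_atoms in Hc as (x & Hx & ->). apply in_image; [dfn|].
  exists (sep F (fun A => E x A)). split.
  - apply in_pow. intros A HA. apply in_sep in HA; [tauto|dfn].
  - apply ext. intro y. rewrite in_atom, in_sep by dfn.
    split; intros [Hy H]; split; auto; intros A HA; rewrite <- (H A HA);
      rewrite in_sep by dfn; tauto.
Qed.

(** A member of [F] contains the whole atom of each of its points, so it is the union of the atoms
    inside it. Hence [F] is an element of a power set computed from [atoms X F] alone. *)
Lemma atoms_unions X F : Sub E F (pow X) -> Sub E F (image bigcup (pow (atoms X F))).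
Proof.
  intros HF A HA. apply in_image; [dfn|].
  exists (sep (atoms X F) (fun c => Sub E c A)). split.
  - apply in_pow. intros c Hc. apply in_sep in Hc; [tauto|dfn].
  - apply ext. intro z. rewrite in_bigcup. split.
    + intro Hz. assert (HzX : E z X) by (apply (proj1 (in_pow X A) (HF A HA)); auto).
      exists (atom X F z). rewrite in_sep, in_atoms, in_atom by dfn.
      split; [split; [eauto|]|split; [auto|tauto]].
      intros y Hy. apply in_atom in Hy as [_ Hy]. now apply Hy.
    + intros (c & Hc & Hz). apply in_sep in Hc as [_ Hc]; [auto|dfn].
Qed.

Lemma atoms_partition X F t : Power E t X ->
  Cellular_family E t (atoms X F) /\
  (forall u, E u (atoms X F) -> Clopen E X t u) /\ Union E X (atoms X F).
Proof.
  intro Ht.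
  assert (Hsub : forall u, E u (atoms X F) -> E u t).
  { intros u Hu. apply Ht. intros z Hz. apply in_atoms in Hu as (x & _ & ->).
    now apply in_atom in Hz. }
  assert (Hself : forall x, E x X -> E x (atom X F x)).
  { intros x Hx. apply in_atom. split; [auto|tauto]. }
  repeat split.
  - auto.
  - intro He. apply in_atoms in H as (x & Hx & ->). apply (He x). auto.
  - intros u v Hu Hv Hne (z & Hzu & Hzv). apply Hne.
    apply in_atoms in Hu as (x & Hx & ->), Hv as (y & Hy & ->).
    apply in_atom in Hzu as [_ Hxz], Hzv as [_ Hyz].
    apply ext. intro w. rewrite !in_atom.
    split; intros [Hw H]; split; auto; intros A HA; specialize (H A HA);
      specialize (Hxz A HA); specialize (Hyz A HA); tauto.
  - auto.
  - exists (sep X (fun z => ~ E z u)). split.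
    + intro z. apply in_sep. dfn.
    + apply Ht. intros z Hz. apply in_sep in Hz; [tauto|dfn].
  - intro Hz. exists (atom X F z). split; auto. apply in_atoms. eauto.
  - intros (y & Hy & Hz). apply Hsub, Ht in Hy. auto.
Qed.

(** * The two implications between the statements *)

Lemma power_iff p x : Power E p x <-> p = pow x.
Proof.
  split; [|intros -> z; apply in_pow].
  intro H. apply ext. intro z. rewrite in_pow. apply H.
Qed.

Lemma clopen_matrix_of_denumerable X t : Discrete_space E X t ->
  (exists d, (forall F, E F d -> Sub E F (pow X) /\ Finite E F) /\ Denumerable E d) ->
  exists m, Clopen_matrix E X t m.
Proof.
  intros [_ Ht] (d & Hd & Hden). apply denumerable_iff, equipotent_sym in Hden.
  apply equipotent_bij in Hden as (F & HF & HF1 & HF2 & HF3).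
  set (H := fun n => atoms X (F n)).
  assert (HH : definable_fun1 E H) by (unfold H; dfn).
  assert (Hfin : forall n, E n omega -> Finite E (H n)).
  { intros n Hn. apply atoms_finite, Hd, HF1, Hn. }
  (* Every family with set of atoms [C] belongs to [pow (image bigcup (pow C))], which is finite
     when [C] is. With only finitely many [C], the denumerable [d] would lie in a finite union of
     finite sets. *)
  assert (Hinf : ~ Finite E (image H omega)).
  { intro Hf. apply omega_infinite. apply equipotent_finite with d.
    { apply bij_equipotent with F; auto. repeat split; auto. }
    apply finite_sub with
      (bigcup (image (fun C => pow (image bigcup (pow C))) (image H omega))).
    - apply finite_bigcup.
      + apply finite_image; [dfn|auto].
      + intros y Hy. apply in_image in Hy as (C & HC & ->); [|dfn].
        apply in_image in HC as (n & Hn & ->); auto.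
        apply finite_pow, finite_image; [dfn|]. apply finite_pow. auto.
    - intros b Hb. destruct (HF3 b Hb) as (n & Hn & ->).
      apply in_bigcup. exists (pow (image bigcup (pow (H n)))). split.
      + apply in_image; [dfn|]. exists (H n). split; auto. apply in_image; eauto.
      + apply in_pow, atoms_unions, Hd, Hb. }
  destruct (infinite_image_omega H HH Hinf) as [m Hm].
  apply bijection_bij in Hm as HB. destruct HB as (HB1 & HB2 & HB3), Hm as (Hm & _).
  exists m, omega, (image H omega). split; [now apply omega_iff|]. split; [exact Hm|].
  split.
  - intros i j c c' Hi Hj Hne Hc Hc'.
    apply (value_spec m _ _ _ _ Hm Hi) in Hc. apply (value_spec m _ _ _ _ Hm Hj) in Hc'.
    subst. auto.
  - intros n c Hn Hc. apply (value_spec m _ _ _ _ Hm Hn) in Hc.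
    assert (HcH : E c (image H omega)) by (subst; auto).
    apply in_image in HcH as (k & Hk & ->); auto. split; auto.
    now apply atoms_partition.
Qed.

(** Equips a bare infinite set with the topology to which the matrix statement is applied in the
    converse direction. *)
Lemma power_discrete X : Discrete_space E X (pow X).
Proof.
  split; [|now apply power_iff]. repeat split.
  - intros u. apply in_pow.
  - intros e He. apply in_pow. intros z Hz. now apply He in Hz.
  - apply in_pow. intro; auto.
  - intros c u Hc Hu. apply in_pow. intros z Hz. apply Hu in Hz as (y & Hy & Hz).
    apply Hc, in_pow in Hy. auto.
  - intros u v w Hu Hv Hw. apply in_pow. intros z Hz. apply Hw in Hz as [Hz _].
    apply in_pow in Hu. auto.
Qed.

Lemma denumerable_of_clopen_matrix X t m f : Discrete_space E X t ->
  (forall F, E F f <-> Sub E F (pow X) /\ Finite E F) -> Clopen_matrix E X t m ->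
  exists d, Sub E d f /\ Denumerable E d.
Proof.
  intros [_ Ht] Hf (w & y & Hw & Hm & Hinj & Hpart).
  apply omega_iff in Hw. subst w. apply power_iff in Ht. subst t.
  assert (Happ : forall n, E n omega -> Maps_to E m n (value m n)).
  { intros n Hn. now apply (value_spec m _ _ _ _ Hm Hn). }
  exists (image (value m) omega). split.
  - intros c Hc. apply in_image in Hc as (n & Hn & ->); [|dfn].
    destruct (Hpart n _ Hn (Happ n Hn)) as (H1 & [H2 _] & _).
    apply Hf. split; auto. intros u Hu. now apply H2.
  - apply denumerable_iff, equipotent_sym, bij_equipotent with (value m); [dfn|].
    repeat split.
    + intros n Hn. apply in_image; [dfn|eauto].
    + intros i j Hi Hj He. apply NNPP. intro Hne.
      apply (Hinj i j _ _ Hi Hj Hne (Happ i Hi) (Happ j Hj) He).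
    + intros b Hb. now apply in_image in Hb; [|dfn].
Qed.

Lemma IQDI_iff_discrete_matrices : IQDI E <-> Discrete_matrices E.
Proof.
  split.
  - intros H X t Ht Hinf. apply clopen_matrix_of_denumerable; auto.
    destruct (H X Hinf) as (p & f & Hp & Hf & d & Hd & Hden).
    apply power_iff in Hp. subst p. exists d. split; auto.
    intros F HF. now apply Hf, Hd.
  - intros H X Hinf. assert (Hd := power_discrete X). destruct (H X _ Hd Hinf) as [m Hm].
    exists (pow X), (sep (pow (pow X)) (Finite E)). split; [now apply power_iff|].
    assert (Hf : Finite_subsets E (sep (pow (pow X)) (Finite E)) (pow X)).
    { intro z. rewrite in_sep, in_pow by dfn. reflexivity. }
    split; [exact Hf|]. now apply denumerable_of_clopen_matrix with X (pow X) m.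
Qed.

End Model.

(** * Closedness of the axioms and the conclusion *)

Lemma bounded_closure n p : bounded n (p n) -> bounded 0 (closure n p).
Proof.
  unfold closure. generalize (p n) as q. clear p.
  induction n as [|n IH]; intros q H; [exact H|].
  rewrite Nat.iter_succ_r. apply IH, H.
Qed.

(** Required by the completeness proof, where the variables serve as witnesses and so must not occur
    free in the axioms. In the two schemas, [closure n] binds exactly the [n] parameter levels left
    free by the instance. *)
Lemma ZF_closed q : ZF q -> bounded 0 q.
Proof.
  destruct 1 as [| | | | | |n p Hp|n p Hp]; try (cbn; lia).
  - apply bounded_closure. cbn -[Nat.sub]. unfold index.
    repeat split; try lia; apply bounded_ren with (1 + n); auto;
      intros [|i] Hi; cbn -[Nat.sub]; unfold index; lia.
  - apply bounded_closure. cbn -[Nat.sub]. unfold index.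
    repeat split; try lia; apply bounded_ren with (2 + n); auto;
      intros [|[|i]] Hi; cbn -[Nat.sub]; unfold index; lia.
Qed.

Theorem proposition4p12 :
  provable ZF
    (sentence (fm_iff IQDI_P infinite_discrete_spaces_admit_clopen_matrices)).
Proof.
  apply completeness.
  - exact ZF_closed.
  - cbn. lia.
  - intros M E s H. apply tr_main. now apply IQDI_iff_discrete_matrices with s.
Qed.
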